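(* Real Value Perception Manipulation (RVPM) can be solved in polynomial time under the $l_\infty$ norm when the number of issues $d$ is a constant, for constructive control and arbitrary scoring rules.
   Context: Spatial election model: $n$ candidates $c_1,\dots,c_n$ and $m$ voters $v_1,\dots,v_m$ are points of $\mathbb R^d$. Each voter ranks candidates by increasing $l_\infty$ distance; closest ranked 1; original rankings have no ties. A scoring rule is a non-increasing $f:\{1,\dots,n\}\to\mathbb R$: a candidate ranked $t$ by a voter receives $f(t)$; totals summed; highest total wins. Given $\epsilon>0$, an adversary may replace target $c_1$ by any $\tilde c_1\in\mathbb R^d$ with $\|\tilde c_1-c_1\|_\infty\le\epsilon$; ties created by the manipulation are broken in the adversary's favor. Constructive control: decide whether some such $\tilde c_1$ makes $c_1$ win (with $c_1$ placed ahead of equidistant candidates, its total is at least every other candidate's total). *)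

(* Defs.v *)
From Stdlib Require Import Reals Lra Lia List ZArith Arith.
Import ListNotations.
Open Scope R_scope.

(* A point of R^d is a function nat -> R of which only the coordinates
   0..d-1 are relevant.  Candidates are indexed 0..n-1 (index 0 is the
   target c_1), voters are indexed 0..m-1.                               *)

Definition point := nat -> R.

Definition linf (d : nat) (x y : point) : R :=
  fold_right Rmax 0 (map (fun k => Rabs (x k - y k)) (seq 0 d)).

Definition Rltb (a b : R) : bool := if Rlt_dec a b then true else false.
Definition Rleb (a b : R) : bool := if Rle_dec a b then true else false.

Definition sumR (l : list R) : R := fold_right Rplus 0 l.

(* Rank (1 = best) given by voter [v] to candidate [j] when the target
   (candidate 0) is placed at [p]; the target is placed ahead of every
   candidate at the same distance (ties broken in the adversary's favour);
   the other candidates never tie among themselves (original rankings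
   have no ties, and they do not move). *)
Definition rank (d n : nat) (cand : nat -> point) (p v : point) (j : nat) : nat :=
  if Nat.eqb j 0 then
    S (length (filter (fun j' => Rltb (linf d v (cand j')) (linf d v p))
                      (seq 1 (n - 1))))
  else
    S (length (filter (fun j' => andb (negb (Nat.eqb j' j))
                                      (Rltb (linf d v (cand j')) (linf d v (cand j))))
                      (seq 1 (n - 1)))
       + (if Rleb (linf d v p) (linf d v (cand j)) then 1 else 0))%nat.

Definition score (d n m : nat) (cand voter : nat -> point) (f : nat -> R)
  (p : point) (j : nat) : R :=
  sumR (map (fun i => f (rank d n cand p (voter i) j)) (seq 0 m)).

Definition target_wins (d n m : nat) (cand voter : nat -> point) (f : nat -> R)
  (p : point) : Prop :=
  forall j, (1 <= j < n)%nat ->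
    score d n m cand voter f p j <= score d n m cand voter f p 0.

Definition controllable (d n m : nat) (cand voter : nat -> point) (f : nat -> R)
  (eps : R) : Prop :=
  exists p : point,
    (forall k, (k < d)%nat -> Rabs (p k - cand 0%nat k) <= eps) /\
    target_wins d n m cand voter f p.

Definition valid_instance (d n m : nat) (cand voter : nat -> point) (f : nat -> R)
  (eps : R) : Prop :=
  (1 <= n)%nat /\ 0 < eps /\
  (forall t1 t2, (1 <= t1)%nat -> (t1 <= t2)%nat -> (t2 <= n)%nat -> f t2 <= f t1) /\
  (forall i j j', (i < m)%nat -> (j < n)%nat -> (j' < n)%nat -> j <> j' ->
     linf d (voter i) (cand j) <> linf d (voter i) (cand j')).

(* Machine model: a real RAM (Blum-Shub-Smale style machine with        *)
(* indirect addressing), unit cost per instruction.                     *)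
(* Memory: nat -> R.  Direct operands are nat literals in the program.
   Indirect addressing requires the address cell to hold a natural
   number exactly (otherwise the machine is stuck, i.e. does not halt). *)

Inductive instr : Type :=
  | IConst (dst : nat) (c : Z)
  | IAdd (dst a b : nat)
  | ISub (dst a b : nat)
  | IMul (dst a b : nat)
  | IDiv (dst a b : nat)
  | ILoad (dst a : nat)
  | IStore (a src : nat)
  | IJumpLe (a b target : nat)
  | IHalt.

Definition program := list instr.

Record state := mkState { pc : nat; mem : nat -> R }.

Definition upd (M : nat -> R) (i : nat) (x : R) : nat -> R :=
  fun k => if Nat.eqb k i then x else M k.

Definition rdiv0 (x y : R) : R := if Req_EM_T y 0 then 0 else x / y.

Inductive step (P : program) : state -> state -> Prop :=
  | st_const : forall s dst c, nth_error P (pc s) = Some (IConst dst c) ->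
      step P s (mkState (S (pc s)) (upd (mem s) dst (IZR c)))
  | st_add : forall s dst a b, nth_error P (pc s) = Some (IAdd dst a b) ->
      step P s (mkState (S (pc s)) (upd (mem s) dst (mem s a + mem s b)))
  | st_sub : forall s dst a b, nth_error P (pc s) = Some (ISub dst a b) ->
      step P s (mkState (S (pc s)) (upd (mem s) dst (mem s a - mem s b)))
  | st_mul : forall s dst a b, nth_error P (pc s) = Some (IMul dst a b) ->
      step P s (mkState (S (pc s)) (upd (mem s) dst (mem s a * mem s b)))
  | st_div : forall s dst a b, nth_error P (pc s) = Some (IDiv dst a b) ->
      step P s (mkState (S (pc s)) (upd (mem s) dst (rdiv0 (mem s a) (mem s b))))
  | st_load : forall s dst a k, nth_error P (pc s) = Some (ILoad dst a) ->
      mem s a = INR k ->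
      step P s (mkState (S (pc s)) (upd (mem s) dst (mem s k)))
  | st_store : forall s a src k, nth_error P (pc s) = Some (IStore a src) ->
      mem s a = INR k ->
      step P s (mkState (S (pc s)) (upd (mem s) k (mem s src)))
  | st_jump_yes : forall s a b t, nth_error P (pc s) = Some (IJumpLe a b t) ->
      mem s a <= mem s b -> step P s (mkState t (mem s))
  | st_jump_no : forall s a b t, nth_error P (pc s) = Some (IJumpLe a b t) ->
      mem s b < mem s a -> step P s (mkState (S (pc s)) (mem s)).

Inductive steps (P : program) : state -> nat -> state -> Prop :=
  | steps_refl : forall s, steps P s 0 s
  | steps_succ : forall s s' s'' t, step P s s' -> steps P s' t s'' ->
      steps P s (S t) s''.

Definition halted (P : program) (s : state) : Prop :=
  nth_error P (pc s) = Some IHalt.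

(* Input encoding of an RVPM instance (d is fixed, hence not encoded):
   M[0] = n, M[1] = m, M[2] = eps,
   M[3 + j*d + k]           = k-th coordinate of candidate j  (j<n, k<d),
   M[3 + n*d + i*d + k]     = k-th coordinate of voter i      (i<m, k<d),
   M[3 + n*d + m*d + t]     = f (t+1)                         (t<n),
   every other cell is 0. *)
Definition encode (d n m : nat) (cand voter : nat -> point) (f : nat -> R)
  (eps : R) : nat -> R :=
  fun a =>
    if Nat.eqb a 0 then INR n
    else if Nat.eqb a 1 then INR m
    else if Nat.eqb a 2 then eps
    else if Nat.ltb a (3 + n * d) then
      cand ((a - 3) / d)%nat ((a - 3) mod d)%nat
    else if Nat.ltb a (3 + n * d + m * d) then
      voter ((a - 3 - n * d) / d)%nat ((a - 3 - n * d) mod d)%nat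
    else if Nat.ltb a (3 + n * d + m * d + n) then
      f (S (a - 3 - n * d - m * d))
    else 0.

Definition init_state (d n m : nat) (cand voter : nat -> point) (f : nat -> R)
  (eps : R) : state := mkState 0 (encode d n m cand voter f eps).

(* Main.v *)
Require Import Defs.
From Stdlib Require Import Reals Lra Lia List ZArith Arith Bool.
Import ListNotations.
Open Scope R_scope.

(* The outcome depends on the position [p] of the target only through the set of
   closed cubes [linf (v_i, .) <= linf (v_i, c_j)] containing [p], hence, coordinate
   by coordinate, on how [p k] compares with the critical values
   [v_i k +- linf (v_i, c_j)]. Adding [c_0 k +- eps] to these, every [p k] in the
   allowed box can be replaced by the midpoint of two critical values, so it suffices
   to test the polynomially many points whose coordinates are such midpoints.

   For the running time, a function of the input and of loop indices is called
   computable when it has uniform machine code with a polynomial time bound; this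
   class is closed under arithmetic, comparison, reading the input and summation
   over a range of polynomial length, so the search is computable because it is an
   expression built from these operations. *)

(** Ties favour the target, so the strict count in its own rank and the weak test in a rival's rank
    are governed by the same closed cubes. Midpoints suffice because a coordinate either is
    critical, hence the midpoint of a critical value with itself, or lies strictly between two
    neighbouring critical values. A coordinate has [2 + 2 * m * (n - 1)] critical values, counted
    with repetition, so at most the square of that many midpoints; [d] nested choices stay
    polynomial because [d] is fixed.

    The obstacle lies in the machine. The input starts at cell 0 and its length depends on [n] and
    [m], so a fixed program can name no cell that is certainly free. The input is therefore moved up
    before anything else, which turns the low cells into registers. From then on nothing is
    allocated: nested expressions follow a stack discipline on registers numbered when the code is
    generated, and points are recomputed coordinate by coordinate instead of being stored. *)

(** * Placing code in a program and running it *)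

Definition code_at (P : program) (p : nat) (c : list instr) : Prop :=
  forall i ins, nth_error c i = Some ins -> nth_error P (p + i) = Some ins.

Lemma code_at_app P p c1 c2 :
  code_at P p (c1 ++ c2) -> code_at P p c1 /\ code_at P (p + length c1) c2.
Proof.
  intros H; split; intros i ins Hi.
  - apply H. rewrite nth_error_app1; [exact Hi|].
    apply nth_error_Some. congruence.
  - rewrite <- Nat.add_assoc. apply H.
    rewrite nth_error_app2 by lia.
    now replace (length c1 + i - length c1)%nat with i by lia.
Qed.

Lemma code_at_cons P p ins c :
  code_at P p (ins :: c) -> nth_error P p = Some ins /\ code_at P (S p) c.
Proof.
  intros H; split.
  - rewrite <- (Nat.add_0_r p). now apply H.
  - intros i ins' Hi. replace (S p + i)%nat with (p + S i)%nat by lia. now apply H.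
Qed.

Lemma code_at_embed (pre c post : program) :
  code_at (pre ++ c ++ post) (length pre) c.
Proof.
  intros i ins Hi. rewrite nth_error_app2 by lia.
  replace (length pre + i - length pre)%nat with i by lia.
  rewrite nth_error_app1; [exact Hi|].
  apply nth_error_Some. congruence.
Qed.

Definition reach (P : program) (p : nat) (M : nat -> R) (T : nat) (p' : nat)
  (M' : nat -> R) : Prop :=
  exists t, (t <= T)%nat /\ steps P (mkState p M) t (mkState p' M').

Lemma steps_trans P s1 t1 s2 : steps P s1 t1 s2 ->
  forall t2 s3, steps P s2 t2 s3 -> steps P s1 (t1 + t2) s3.
Proof.
  induction 1 as [|s s' s'' t Hs _ IH]; intros t2 s3 H2; simpl; [exact H2|].
  eapply steps_succ; eauto.
Qed.

Lemma reach_refl P p M : reach P p M 0 p M.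
Proof. exists 0%nat; split; [lia|constructor]. Qed.

Lemma reach_trans P p1 M1 T1 p2 M2 T2 p3 M3 :
  reach P p1 M1 T1 p2 M2 -> reach P p2 M2 T2 p3 M3 ->
  reach P p1 M1 (T1 + T2) p3 M3.
Proof.
  intros (t1 & L1 & H1) (t2 & L2 & H2).
  exists (t1 + t2)%nat; split; [lia|]. eapply steps_trans; eauto.
Qed.

Lemma reach_weaken P p1 M1 T1 T2 p2 M2 :
  reach P p1 M1 T1 p2 M2 -> (T1 <= T2)%nat -> reach P p1 M1 T2 p2 M2.
Proof. intros (t & L & H) HT. exists t; split; [lia|exact H]. Qed.

Lemma reach_step P p M p' M' T p'' M'' :
  step P (mkState p M) (mkState p' M') -> reach P p' M' T p'' M'' ->
  reach P p M (S T) p'' M''.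
Proof.
  intros Hs (t & L & H). exists (S t); split; [lia|].
  eapply steps_succ; eauto.
Qed.

Section Instructions.
Context (P : program) (p : nat) (M : nat -> R) (T p' : nat) (M' : nat -> R).

(** The instruction rules are in continuation form: chaining them executes a straight-line fragment
    symbolically, and the final memory is found by unification. *)
Lemma reach_const dst c : nth_error P p = Some (IConst dst c) ->
  reach P (S p) (upd M dst (IZR c)) T p' M' -> reach P p M (S T) p' M'.
Proof. intros H; apply reach_step. now apply (st_const P (mkState p M)). Qed.

Lemma reach_add dst a b : nth_error P p = Some (IAdd dst a b) ->
  reach P (S p) (upd M dst (M a + M b)) T p' M' -> reach P p M (S T) p' M'.
Proof. intros H; apply reach_step. now apply (st_add P (mkState p M)). Qed.

Lemma reach_sub dst a b : nth_error P p = Some (ISub dst a b) ->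
  reach P (S p) (upd M dst (M a - M b)) T p' M' -> reach P p M (S T) p' M'.
Proof. intros H; apply reach_step. now apply (st_sub P (mkState p M)). Qed.

Lemma reach_mul dst a b : nth_error P p = Some (IMul dst a b) ->
  reach P (S p) (upd M dst (M a * M b)) T p' M' -> reach P p M (S T) p' M'.
Proof. intros H; apply reach_step. now apply (st_mul P (mkState p M)). Qed.

Lemma reach_div dst a b : nth_error P p = Some (IDiv dst a b) ->
  reach P (S p) (upd M dst (rdiv0 (M a) (M b))) T p' M' -> reach P p M (S T) p' M'.
Proof. intros H; apply reach_step. now apply (st_div P (mkState p M)). Qed.

Lemma reach_load dst a k : nth_error P p = Some (ILoad dst a) -> M a = INR k ->
  reach P (S p) (upd M dst (M k)) T p' M' -> reach P p M (S T) p' M'.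
Proof. intros H Hk; apply reach_step. now apply (st_load P (mkState p M)) with a. Qed.

Lemma reach_store a src k : nth_error P p = Some (IStore a src) -> M a = INR k ->
  reach P (S p) (upd M k (M src)) T p' M' -> reach P p M (S T) p' M'.
Proof. intros H Hk; apply reach_step. now apply (st_store P (mkState p M)) with a. Qed.

Lemma reach_jump_yes a b q : nth_error P p = Some (IJumpLe a b q) -> M a <= M b ->
  reach P q M T p' M' -> reach P p M (S T) p' M'.
Proof. intros H Hk; apply reach_step. now apply (st_jump_yes P (mkState p M)) with a b. Qed.

Lemma reach_jump_no a b q : nth_error P p = Some (IJumpLe a b q) -> M b < M a ->
  reach P (S p) M T p' M' -> reach P p M (S T) p' M'.
Proof. intros H Hk; apply reach_step. now apply (st_jump_no P (mkState p M)) with a b q. Qed.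

End Instructions.

Lemma upd_same M i x : upd M i x i = x.
Proof. unfold upd. now rewrite Nat.eqb_refl. Qed.

Lemma upd_other M i x k : k <> i -> upd M i x k = M k.
Proof. intros H. unfold upd. apply Nat.eqb_neq in H. now rewrite H. Qed.

Ltac upd_simpl :=
  repeat (rewrite upd_same || rewrite upd_other by lia).

(** * Polynomial bounds *)

Definition poly_bounded (T : nat -> nat) : Prop :=
  exists C e, forall N, (T N <= C * (N + 1) ^ e)%nat.

Lemma poly_bounded_const c : poly_bounded (fun _ => c).
Proof. exists c, 0%nat. intros N. simpl. lia. Qed.

Lemma poly_bounded_id : poly_bounded (fun N => N).
Proof. exists 1%nat, 1%nat. intros N. simpl. lia. Qed.

(** Powers of [N + 1] are at least 1, even at [N = 0], so the exponent [e1 + e2] dominates both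
    summands. *)
Lemma poly_bounded_add T1 T2 :
  poly_bounded T1 -> poly_bounded T2 -> poly_bounded (fun N => T1 N + T2 N)%nat.
Proof.
  intros (C1 & e1 & H1) (C2 & e2 & H2). exists (C1 + C2)%nat, (e1 + e2)%nat.
  intros N. specialize (H1 N). specialize (H2 N). rewrite Nat.pow_add_r.
  assert (1 <= (N + 1) ^ e1)%nat by (apply Nat.neq_0_lt_0, Nat.pow_nonzero; lia).
  assert (1 <= (N + 1) ^ e2)%nat by (apply Nat.neq_0_lt_0, Nat.pow_nonzero; lia).
  nia.
Qed.

Lemma poly_bounded_mul T1 T2 :
  poly_bounded T1 -> poly_bounded T2 -> poly_bounded (fun N => T1 N * T2 N)%nat.
Proof.
  intros (C1 & e1 & H1) (C2 & e2 & H2). exists (C1 * C2)%nat, (e1 + e2)%nat.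
  intros N. specialize (H1 N). specialize (H2 N). rewrite Nat.pow_add_r.
  transitivity ((C1 * (N + 1) ^ e1) * (C2 * (N + 1) ^ e2))%nat.
  - now apply Nat.mul_le_mono.
  - lia.
Qed.

Lemma sumR_app l1 l2 : sumR (l1 ++ l2) = sumR l1 + sumR l2.
Proof.
  induction l1 as [|x l1 IH]; simpl; [lra|].
  fold (sumR (l1 ++ l2)) (sumR l1). rewrite IH. lra.
Qed.

Lemma sumR_seq_S (g : nat -> R) k :
  sumR (map g (seq 0 (S k))) = sumR (map g (seq 0 k)) + g k.
Proof. rewrite seq_S, map_app, sumR_app. simpl. lra. Qed.

(** * Functions computed by uniform code in polynomial time *)

Section Computability.
Context {X : Type} (inp : X -> nat -> R) (size : X -> nat).

(* Calling convention: cell 0 points to the relocated input, the loop indices [gamma]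
   are held in the registers [rho], and the registers from [s] on are scratch. *)
Definition env_ok (x : X) (gamma : list nat) (rho : list nat) (s base : nat)
  (M : nat -> R) : Prop :=
  (0 < s)%nat /\ M 0%nat = INR base /\ (forall a, M (base + a)%nat = inp x a) /\
  Forall2 (fun r g => (r < s)%nat /\ M r = INR g) rho gamma.

(** Memory changes only in the scratch window from [s] to [l], which lies above the loop registers
    and below the input, so both survive. *)
Lemma env_ok_mono x gamma rho s s' l base M M' :
  env_ok x gamma rho s base M -> (s <= s')%nat -> (l < base)%nat ->
  (forall r, (r < s \/ l < r)%nat -> M' r = M r) ->
  env_ok x gamma rho s' base M'.
Proof.
  intros (H0 & Hb & Hi & Hr) Hs Hl Heq. repeat split.
  - lia.
  - rewrite Heq by lia. exact Hb.
  - intros a. rewrite Heq by lia. apply Hi.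
  - eapply Forall2_impl; [|exact Hr]. intros r g [Hrs Hg]. split; [lia|].
    rewrite Heq by lia. exact Hg.
Qed.

(* [gen rho s p] is position-dependent code, placed at address [p], that leaves the
   value in register [s] and uses no register above [s + h]. *)
Definition computable (F : X -> list nat -> R) : Prop :=
  exists (h : nat) (gen : list nat -> nat -> nat -> list instr) (T : nat -> nat),
  poly_bounded T /\
  forall P rho s p x gamma M base,
    code_at P p (gen rho s p) -> (s + h < base)%nat ->
    env_ok x gamma rho s base M ->
    exists M', reach P p M (T (size x)) (p + length (gen rho s p)) M' /\
      M' s = F x gamma /\
      (forall r, (r < s \/ s + h < r)%nat -> M' r = M r).

Lemma computable_ext F G :
  (forall x gamma, F x gamma = G x gamma) -> computable F -> computable G.
Proof.
  intros E (h & gen & T & HT & H). exists h, gen, T. split; [exact HT|].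
  intros P rho s p x gamma M base HP Hs He.
  destruct (H P rho s p x gamma M base HP Hs He) as (M' & H1 & H2 & H3).
  exists M'. rewrite <- E. auto.
Qed.

Lemma computable_const (c : Z) : computable (fun _ _ => IZR c).
Proof.
  exists 0%nat, (fun _ s _ => [IConst s c]), (fun _ => 1%nat).
  split; [apply poly_bounded_const|].
  intros P rho s p x gamma M base HP Hs He.
  apply code_at_cons in HP as [HP _].
  exists (upd M s (IZR c)). split; [|split].
  - eapply reach_const; [exact HP|]. simpl. rewrite Nat.add_1_r. apply reach_refl.
  - apply upd_same.
  - intros r Hr. apply upd_other. lia.
Qed.

(** The generator, not the machine, inspects the register list: it is as long as [gamma], and when
    it is empty the default index 0 is emitted. *)
Lemma computable_hd : computable (fun _ gamma => INR (hd 0%nat gamma)).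
Proof.
  exists 0%nat, (fun rho s _ => IConst s 0 ::
    match rho with [] => [] | r :: _ => [IAdd s s r] end), (fun _ => 2%nat).
  split; [apply poly_bounded_const|].
  intros P rho s p x gamma M base HP Hs He.
  destruct He as (_ & _ & _ & Hr). apply code_at_cons in HP as [HP HP'].
  destruct Hr as [|r g rho gamma [Hr Hg] _].
  - exists (upd M s 0). split; [|split].
    + eapply reach_weaken; [eapply reach_const; [exact HP|]|]; simpl;
        [rewrite Nat.add_1_r; apply reach_refl|lia].
    + apply upd_same.
    + intros r Hr. apply upd_other. lia.
  - apply code_at_cons in HP' as [HP' _].
    exists (upd (upd M s 0) s (M r)). split; [|split].
    + eapply reach_const; [exact HP|]. eapply reach_add; [exact HP'|].
      upd_simpl. rewrite Rplus_0_l. simpl.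
      replace (p + 2)%nat with (S (S p)) by lia. apply reach_refl.
    + upd_simpl. exact Hg.
    + intros r' Hr'. now upd_simpl.
Qed.

(** Weakening under a loop, with indices in de Bruijn style: the generator forgets the innermost
    register, at no cost in instructions. *)
Lemma computable_tl F :
  computable F -> computable (fun x gamma => F x (tl gamma)).
Proof.
  intros (h & gen & T & HT & H). exists h, (fun rho => gen (tl rho)), T.
  split; [exact HT|].
  intros P rho s p x gamma M base HP Hs (H0 & Hb & Hi & Hr).
  apply H with base; [exact HP|exact Hs|]. repeat split; try assumption.
  destruct Hr; simpl; [constructor|assumption].
Qed.

Lemma computable_skipn k F :
  computable F -> computable (fun x gamma => F x (skipn k gamma)).
Proof.
  revert F. induction k as [|k IH]; intros F HF; [exact HF|].
  apply computable_ext with (fun x gamma => F x (skipn k (tl gamma))).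
  - intros x [|g gamma]; simpl; [now rewrite skipn_nil|reflexivity].
  - apply (computable_tl (fun x gamma => F x (skipn k gamma))). now apply IH.
Qed.

(** Stack discipline: [F] leaves its value in [s], then [G] runs from [S s] and cannot touch it.
    [tail] receives its own address because jump targets are absolute. *)
Lemma computable_pair (tail_time : nat) (tail : nat -> nat -> list instr) (op : R -> R -> R) F G :
  (forall P s p M, code_at P p (tail s p) ->
     exists M', reach P p M tail_time (p + length (tail s p)) M' /\
       M' s = op (M s) (M (S s)) /\
       (forall r, (r < s \/ S s < r)%nat -> M' r = M r)) ->
  computable F -> computable G ->
  computable (fun x gamma => op (F x gamma) (G x gamma)).
Proof.
  intros Htail (h1 & g1 & T1 & HT1 & H1) (h2 & g2 & T2 & HT2 & H2).
  exists (S (h1 + h2)),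
    (fun rho s p => let c1 := g1 rho s p in
       let c2 := g2 rho (S s) (p + length c1)%nat in
       c1 ++ c2 ++ tail s (p + length c1 + length c2)%nat),
    (fun N => T1 N + (T2 N + tail_time))%nat.
  split.
  { apply poly_bounded_add; [exact HT1|]. apply poly_bounded_add;
      [exact HT2|apply poly_bounded_const]. }
  intros P rho s p x gamma M base HP Hs He. cbv zeta in *.
  apply code_at_app in HP as [HP1 HP]. apply code_at_app in HP as [HP2 HP3].
  destruct (H1 P rho s p x gamma M base HP1 ltac:(lia) He) as (M1 & R1 & V1 & A1).
  assert (He1 : env_ok x gamma rho (S s) base M1).
  { eapply env_ok_mono with (l := (s + h1)%nat); [exact He|lia|lia|exact A1]. }
  destruct (H2 P rho (S s) _ x gamma M1 base HP2 ltac:(lia) He1) as (M2 & R2 & V2 & A2).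
  destruct (Htail P s _ M2 HP3) as (M3 & R3 & V3 & A3).
  exists M3. split; [|split].
  - rewrite !length_app, !Nat.add_assoc. rewrite <- (Nat.add_assoc (T1 _)).
    eapply reach_trans; [exact R1|]. eapply reach_trans; [exact R2|exact R3].
  - rewrite V3, V2, A2 by lia. now rewrite V1.
  - intros r Hr. rewrite A3, A2, A1 by lia. reflexivity.
Qed.

Lemma computable_add F G : computable F -> computable G ->
  computable (fun x gamma => F x gamma + G x gamma).
Proof.
  apply (computable_pair 1 (fun s _ => [IAdd s s (S s)])).
  intros P s p M HP. apply code_at_cons in HP as [HP _].
  exists (upd M s (M s + M (S s))). split; [|split].
  - eapply reach_add; [exact HP|]. simpl. rewrite Nat.add_1_r. apply reach_refl.
  - now upd_simpl.
  - intros r Hr. now upd_simpl.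
Qed.

Lemma computable_sub F G : computable F -> computable G ->
  computable (fun x gamma => F x gamma - G x gamma).
Proof.
  apply (computable_pair 1 (fun s _ => [ISub s s (S s)])).
  intros P s p M HP. apply code_at_cons in HP as [HP _].
  exists (upd M s (M s - M (S s))). split; [|split].
  - eapply reach_sub; [exact HP|]. simpl. rewrite Nat.add_1_r. apply reach_refl.
  - now upd_simpl.
  - intros r Hr. now upd_simpl.
Qed.

Lemma computable_mul F G : computable F -> computable G ->
  computable (fun x gamma => F x gamma * G x gamma).
Proof.
  apply (computable_pair 1 (fun s _ => [IMul s s (S s)])).
  intros P s p M HP. apply code_at_cons in HP as [HP _].
  exists (upd M s (M s * M (S s))). split; [|split].
  - eapply reach_mul; [exact HP|]. simpl. rewrite Nat.add_1_r. apply reach_refl.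
  - now upd_simpl.
  - intros r Hr. now upd_simpl.
Qed.

Lemma computable_rdiv0 F G : computable F -> computable G ->
  computable (fun x gamma => rdiv0 (F x gamma) (G x gamma)).
Proof.
  apply (computable_pair 1 (fun s _ => [IDiv s s (S s)])).
  intros P s p M HP. apply code_at_cons in HP as [HP _].
  exists (upd M s (rdiv0 (M s) (M (S s)))). split; [|split].
  - eapply reach_div; [exact HP|]. simpl. rewrite Nat.add_1_r. apply reach_refl.
  - now upd_simpl.
  - intros r Hr. now upd_simpl.
Qed.

Definition computableb (b : X -> list nat -> bool) : Prop :=
  computable (fun x gamma => INR (Nat.b2n (b x gamma))).

Definition computablen (a : X -> list nat -> nat) : Prop :=
  computable (fun x gamma => INR (a x gamma)).

Lemma computableb_leb F G : computable F -> computable G ->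
  computableb (fun x gamma => Rleb (F x gamma) (G x gamma)).
Proof.
  apply (computable_pair 3
    (* Comparing [s] with itself gives an unconditional jump over the instruction that writes 1. *)
    (fun s p => [IJumpLe s (S s) (p + 3); IConst s 0; IJumpLe s s (p + 4); IConst s 1])
    (fun u v => INR (Nat.b2n (Rleb u v)))).
  intros P s p M HP.
  apply code_at_cons in HP as [HP1 HP]. apply code_at_cons in HP as [HP2 HP].
  apply code_at_cons in HP as [HP3 HP]. apply code_at_cons in HP as [HP4 _].
  unfold Rleb. simpl length. destruct (Rle_dec (M s) (M (S s))) as [Hle|Hgt].
  - exists (upd M s 1). split; [|split].
    + apply reach_weaken with 2%nat; [|lia].
      eapply reach_jump_yes; [exact HP1|exact Hle|].
      eapply reach_const; [rewrite <- HP4; f_equal; lia|].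
      replace (p + 4)%nat with (S (p + 3)) by lia. apply reach_refl.
    + now upd_simpl.
    + intros r Hr. now upd_simpl.
  - exists (upd M s 0). split; [|split].
    + eapply reach_jump_no; [exact HP1|lra|].
      eapply reach_const; [exact HP2|].
      eapply reach_jump_yes; [exact HP3|lra|]. apply reach_refl.
    + now upd_simpl.
    + intros r Hr. now upd_simpl.
Qed.

(** Adding cell 0 turns an input index into a machine address; it is the image of a natural number,
    so the indirect load does not get stuck. *)
Lemma computable_input a : computablen a ->
  computable (fun x gamma => inp x (a x gamma)).
Proof.
  intros (h & g & T & HT & H).
  exists h, (fun rho s p => g rho s p ++ [IAdd s s 0; ILoad s s]), (fun N => T N + 2)%nat.
  split; [apply poly_bounded_add; [exact HT|apply poly_bounded_const]|].
  intros P rho s p x gamma M base HP Hs He.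
  apply code_at_app in HP as [HP1 HP]. apply code_at_cons in HP as [HP2 HP].
  apply code_at_cons in HP as [HP3 _].
  destruct (H P rho s p x gamma M base HP1 Hs He) as (M1 & R1 & V1 & A1).
  destruct He as (H0 & Hb & Hi & _).
  exists (upd (upd M1 s (M1 s + M1 0%nat)) s (inp x (a x gamma))).
  split; [|split].
  - eapply reach_trans; [exact R1|].
    eapply reach_add; [exact HP2|].
    eapply reach_load with (k := (base + a x gamma)%nat); [exact HP3| |].
    + upd_simpl. rewrite V1, A1, Hb, plus_INR by lia. lra.
    + rewrite upd_other by lia. rewrite (A1 (base + a x gamma)%nat), Hi by lia. rewrite length_app. simpl.
      replace (p + (length (g rho s p) + 2))%nat with (S (S (p + length (g rho s p)))) by lia.
      apply reach_refl.
  - now upd_simpl.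
  - intros r Hr. upd_simpl. apply A1, Hr.
Qed.

(** The only loop from which all others derive. Its length [b x] is independent of the enclosing
    indices and bounded in the size, so nesting loops multiplies polynomials. In the body the
    counter is the head of the index list. *)
Lemma computable_sum (F : X -> list nat -> nat -> R) (b : X -> nat) (B : nat -> nat) :
  poly_bounded B -> (forall x, (b x <= B (size x))%nat) ->
  computablen (fun x _ => b x) ->
  computable (fun x gamma => F x (tl gamma) (hd 0%nat gamma)) ->
  computable (fun x gamma => sumR (map (F x gamma) (seq 0 (b x)))).
Proof.
  intros HB HbB (h1 & g1 & T1 & HT1 & H1) (h2 & g2 & T2 & HT2 & H2).
  (* Registers: s accumulates, s+1 holds the bound, s+2 the counter, s+3 the summand. *)
  exists (h1 + h2 + 3)%nat,
    (fun rho s p =>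
       let c1 := g1 rho (s + 1)%nat p in
       let L := (p + length c1 + 2)%nat in
       let c2 := g2 ((s + 2) :: rho)%nat (s + 3)%nat (S L) in
       c1 ++ [IConst s 0; IConst (s + 2) 0; IJumpLe (s + 1) (s + 2) (S L + length c2 + 4)] ++
       c2 ++ [IAdd s s (s + 3); IConst (s + 3) 1; IAdd (s + 2) (s + 2) (s + 3); IJumpLe s s L]),
    (* Besides its body, an iteration runs the test and four closing instructions; the 2 initialises
       accumulator and counter, and the final 1 is the exit jump. *)
    (fun N => T1 N + (2 + (B N * (T2 N + 5) + 1)))%nat.
  split.
  { repeat first [apply poly_bounded_add | apply poly_bounded_mul |
                  apply poly_bounded_const | assumption]. }
  intros P rho s p x gamma M base HP Hs He. cbv zeta in *.
  set (c1 := g1 rho (s + 1)%nat p) in *.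
  set (L := (p + length c1 + 2)%nat) in *.
  set (c2 := g2 ((s + 2) :: rho)%nat (s + 3)%nat (S L)) in *.
  apply code_at_app in HP as [HP1 HP].
  apply code_at_app in HP as [HPi HP]. apply code_at_app in HP as [HP2 HP].
  apply code_at_cons in HPi as [I1 HPi]. apply code_at_cons in HPi as [I2 HPi].
  apply code_at_cons in HPi as [I3 _].
  apply code_at_cons in HP as [J1 HP]. apply code_at_cons in HP as [J2 HP].
  apply code_at_cons in HP as [J3 HP]. apply code_at_cons in HP as [J4 _].
  simpl length in *.
  replace (p + length c1 + 3)%nat with (S L) in * by (unfold L; lia).
  replace (S (S (p + length c1))) with L in I3 by (unfold L; lia).
  assert (He0 : env_ok x gamma rho (s + 1) base M).
  { eapply env_ok_mono with (l := s); [exact He|lia|lia|reflexivity]. }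
  destruct (H1 P rho (s + 1)%nat p x gamma M base HP1 ltac:(lia) He0) as (M1 & R1 & V1 & A1).
  set (M2 := upd (upd M1 s 0) (s + 2) 0).
  (* Invariant at the loop head [L] after [k] iterations. *)
  assert (Loop : forall k, (k <= b x)%nat -> exists M',
    reach P L M2 (k * (T2 (size x) + 5)) L M' /\
    M' s = sumR (map (F x gamma) (seq 0 k)) /\ M' (s + 1)%nat = INR (b x) /\
    M' (s + 2)%nat = INR k /\
    (forall r, (r < s \/ s + (h1 + h2 + 3) < r)%nat -> M' r = M r)).
  { induction k as [|k IH]; intros Hk.
    - exists M2. unfold M2. simpl. repeat split; try (upd_simpl; reflexivity).
      + apply reach_refl.
      + upd_simpl. exact V1.
      + intros r Hr. upd_simpl. apply A1. lia.
    - destruct IH as (M' & R' & Va & Vb & Vc & A'); [lia|].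
      assert (He' : env_ok x (k :: gamma) ((s + 2) :: rho)%nat (s + 3)%nat base M').
      { destruct (env_ok_mono x gamma rho s (s + 3) (s + (h1 + h2 + 3)) base M M' He
          ltac:(lia) Hs A') as (E0 & E1 & E2 & E3).
        repeat split; try assumption. constructor; [split; [lia|exact Vc]|exact E3]. }
      destruct (H2 P _ _ _ x (k :: gamma) M' base HP2 ltac:(lia) He') as (M3 & R3 & V3 & A3).
      simpl in V3. fold c2 in R3.
      eexists. split; [|split; [|split; [|split]]].
      + replace (S k * (T2 (size x) + 5))%nat
          with (k * (T2 (size x) + 5) + S (T2 (size x) + 4))%nat by lia.
        eapply reach_trans; [exact R'|].
        eapply reach_jump_no; [exact I3| |].
        { rewrite Vb, Vc. apply lt_INR. lia. }
        eapply reach_trans; [exact R3|].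
        eapply reach_add; [exact J1|]. eapply reach_const; [exact J2|].
        eapply reach_add; [exact J3|]. eapply reach_jump_yes; [exact J4|lra|].
        apply reach_refl.
      + upd_simpl. rewrite sumR_seq_S, V3, A3, Va by lia. reflexivity.
      + upd_simpl. rewrite A3 by lia. exact Vb.
      + upd_simpl. rewrite A3, Vc, S_INR by lia. reflexivity.
      + intros r Hr. upd_simpl. rewrite A3 by lia. apply A'. lia. }
  destruct (Loop (b x) (le_n _)) as (M' & R' & Va & Vb & Vc & A').
  exists M'. split; [|split; [exact Va|exact A']].
  eapply reach_trans; [exact R1|].
  eapply reach_trans with (T1 := 2%nat) (p2 := L) (M2 := M2).
  { eapply reach_const; [exact I1|]. eapply reach_const; [exact I2|].
    replace (S (S (p + length (g1 rho (s + 1)%nat p)))) with L by (unfold L, c1; lia).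
    apply reach_refl. }
  eapply reach_trans with (T1 := (B (size x) * (T2 (size x) + 5))%nat).
  { eapply reach_weaken; [exact R'|]. apply Nat.mul_le_mono_r, HbB. }
  eapply reach_jump_yes; [exact I3|rewrite Vb, Vc; lra|].
  rewrite length_app. simpl length. rewrite length_app. simpl length.
  replace (p + (length c1 + S (S (S (length c2 + 4)))))%nat with (S L + length c2 + 4)%nat
    by (unfold L; lia).
  apply reach_refl.
Qed.

End Computability.

(* Moving the input above the registers *)
Tactic Notation "next" hyp(HP) ident(J) := apply code_at_cons in HP as [J HP].

Lemma reach_repeat_double P k : forall p M,
  code_at P p (repeat (IAdd 1 1 1) k) ->
  exists M', reach P p M k (p + k) M' /\ M' 1%nat = 2 ^ k * M 1%nat /\
    (forall r, r <> 1%nat -> M' r = M r).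
Proof.
  induction k as [|k IH]; intros p M HP.
  - exists M. rewrite Nat.add_0_r. split; [apply reach_refl|]. split; [simpl; lra|auto].
  - simpl in HP. apply code_at_cons in HP as [H1 HP].
    destruct (IH (S p) (upd M 1 (M 1%nat + M 1%nat)) HP) as (M' & R' & V & A).
    exists M'. split; [|split].
    + eapply reach_add; [exact H1|]. rewrite <- Nat.add_succ_comm. exact R'.
    + rewrite V, upd_same. simpl. lra.
    + intros r Hr. rewrite A by exact Hr. now upd_simpl.
Qed.

Lemma reach_repeat_add P k : forall p M,
  code_at P p (repeat (IAdd 1 1 0) k) ->
  exists M', reach P p M k (p + k) M' /\ M' 1%nat = M 1%nat + INR k * M 0%nat /\
    (forall r, r <> 1%nat -> M' r = M r).
Proof.
  induction k as [|k IH]; intros p M HP.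
  - exists M. rewrite Nat.add_0_r. split; [apply reach_refl|]. split; [simpl; lra|auto].
  - cbn [repeat] in HP. apply code_at_cons in HP as [H1 HP].
    destruct (IH (S p) (upd M 1 (M 1%nat + M 0%nat)) HP) as (M' & R' & V & A).
    exists M'. split; [|split].
    + eapply reach_add; [exact H1|]. rewrite <- Nat.add_succ_comm. exact R'.
    + rewrite V, S_INR. upd_simpl. lra.
    + intros r Hr. rewrite A by exact Hr. now upd_simpl.
Qed.

(* The input may occupy every cell that the program can name, so an address
   [2^d * m + k * n] beyond it is first built inside cell 1 itself, by
   operations that can be undone once some low cells have been saved there. *)
Definition save_low (d k : nat) : program :=
  [IStore 1 2; IConst 2 1; IAdd 1 1 2; IStore 1 3; IAdd 1 1 2; IStore 1 4;
   IAdd 1 1 2; IStore 1 5; IConst 3 5; ISub 1 1 3; IStore 1 0;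
   IConst 3 (Z.of_nat k); IMul 3 3 0; ISub 3 1 3; IConst 4 2; IAdd 3 3 4;
   IConst 4 (2 ^ Z.of_nat d); IDiv 3 3 4; IAdd 4 1 2; IStore 4 3; IConst 3 6].

Lemma save_low_correct P p d k n m base w M :
  code_at P p (save_low d k) ->
  (6 <= base)%nat ->
  INR base + 2 = 2 ^ d * INR m + INR k * INR n ->
  w 0%nat = INR n -> w 1%nat = INR m ->
  M 1%nat = INR base + 2 -> (forall r, r <> 1%nat -> M r = w r) ->
  exists M', reach P p M 21 (p + 21) M' /\
    M' 1%nat = INR base /\ M' 2%nat = 1 /\ M' 3%nat = 6 /\
    (forall a, (a < 6)%nat -> M' (base + a)%nat = w a) /\
    (forall r, (6 <= r < base \/ base + 6 <= r)%nat -> M' r = w r).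
Proof.
  intros HP Hb Hbase Hn Hm H1 Hw. unfold save_low in HP.
  eexists. split.
  { replace (p + 21)%nat
      with (S (S (S (S (S (S (S (S (S (S (S (S (S (S (S (S (S (S (S (S (S p)))))))))))))))))))))
      by lia.
    (* Cell 2 is freed first, because cells 0 and 1 hold [n] and the address that encodes [m]. This
       is why cell 1 starts at [base + 2]. *)
    next HP I. eapply reach_store with (k := (base + 2)%nat);
      [exact I|rewrite H1, plus_INR; simpl; lra|]. rewrite (Hw 2%nat) by lia.
    next HP J. eapply reach_const; [exact J|]. clear I J.
    next HP I. eapply reach_add; [exact I|]. upd_simpl. rewrite H1.
    next HP J. eapply reach_store with (k := (base + 3)%nat);
      [exact J|upd_simpl; rewrite plus_INR; simpl; lra|].
    upd_simpl. rewrite (Hw 3%nat) by lia. clear I J.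
    next HP I. eapply reach_add; [exact I|]. upd_simpl.
    next HP J. eapply reach_store with (k := (base + 4)%nat);
      [exact J|upd_simpl; rewrite plus_INR; simpl; lra|].
    upd_simpl. rewrite (Hw 4%nat) by lia. clear I J.
    next HP I. eapply reach_add; [exact I|]. upd_simpl.
    next HP J. eapply reach_store with (k := (base + 5)%nat);
      [exact J|upd_simpl; rewrite plus_INR; simpl; lra|].
    upd_simpl. rewrite (Hw 5%nat) by lia. clear I J.
    next HP I. eapply reach_const; [exact I|]. clear I.
    next HP I. eapply reach_sub; [exact I|]. upd_simpl. clear I.
    replace (INR base + 2 + 1 + 1 + 1 - 5) with (INR base) by lra.
    next HP I. eapply reach_store with (k := base); [exact I|now upd_simpl|].
    upd_simpl. rewrite (Hw 0%nat), Hn by lia. clear I.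
    next HP I. eapply reach_const; [exact I|]. clear I. rewrite <- INR_IZR_INZ.
    next HP I. eapply reach_mul; [exact I|]. upd_simpl. rewrite (Hw 0%nat), Hn by lia. clear I.
    next HP I. eapply reach_sub; [exact I|]. upd_simpl. clear I.
    next HP I. eapply reach_const; [exact I|]. clear I.
    next HP I. eapply reach_add; [exact I|]. upd_simpl. clear I.
    next HP I. eapply reach_const; [exact I|]. clear I.
    next HP I. eapply reach_div; [exact I|]. upd_simpl. clear I.
    assert (Hd : IZR (2 ^ Z.of_nat d) = 2 ^ d) by (rewrite <- pow_IZR; reflexivity).
    assert (Hd0 : 2 ^ d <> 0) by (apply pow_nonzero; lra).
    (* The original content [m] of cell 1 is recovered by undoing the address: remove [k * n], then
       divide by [2 ^ d]. *)
    replace (rdiv0 (INR base - INR k * INR n + 2) (IZR (2 ^ Z.of_nat d))) with (INR m).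
    2:{ unfold rdiv0. rewrite Hd. destruct (Req_EM_T (2 ^ d) 0); [contradiction|].
        replace (INR base - INR k * INR n + 2) with (2 ^ d * INR m) by lra. now field. }
    next HP I. eapply reach_add; [exact I|]. upd_simpl. clear I.
    next HP I. eapply reach_store with (k := (base + 1)%nat);
      [exact I|upd_simpl; rewrite plus_INR; simpl; lra|]. upd_simpl. clear I.
    next HP I. eapply reach_const; [exact I|]. apply reach_refl. }
  split; [now upd_simpl|]. split; [now upd_simpl|]. split; [now upd_simpl|]. split.
  - intros a Ha.
    do 6 (destruct a as [|a];
      [rewrite ?Nat.add_0_r; upd_simpl; first [reflexivity | now symmetry]|]).
    lia.
  - intros r Hr. upd_simpl. apply Hw. lia.
Qed.

(** Cell 1 holds [base], cell 2 the constant 1 and cell 3 the source address. Sources stay below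
    [base] and targets do not, so no source is overwritten. The last two instructions put [base]
    into cell 0, as the calling convention demands. *)
Definition copy_loop (L : nat) : program :=
  [IJumpLe 1 3 (L + 6); IAdd 4 1 3; ILoad 5 3; IStore 4 5; IAdd 3 3 2; IJumpLe 0 0 L;
   IConst 0 0; IAdd 0 0 1].

Lemma copy_loop_correct P L base w M :
  code_at P L (copy_loop L) ->
  (6 <= base)%nat ->
  M 1%nat = INR base -> M 2%nat = 1 -> M 3%nat = 6 ->
  (forall a, (a < 6)%nat -> M (base + a)%nat = w a) ->
  (forall r, (6 <= r < base \/ base + 6 <= r)%nat -> M r = w r) ->
  (forall a, (base <= a)%nat -> w a = 0) ->
  exists M', reach P L M (6 * base + 3) (L + 8) M' /\
    M' 0%nat = INR base /\ forall a, M' (base + a)%nat = w a.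
Proof.
  intros HP Hb H1 H2 H3 Hlow Hrest Hz. unfold copy_loop in HP.
  next HP I1. next HP I2. next HP I3. next HP I4. next HP I5. next HP I6.
  next HP I7. next HP I8.
  assert (Loop : forall j, (6 + j <= base)%nat -> exists M',
    reach P L M (6 * j) L M' /\ M' 1%nat = INR base /\ M' 2%nat = 1 /\
    M' 3%nat = INR (6 + j) /\
    (forall a, (a < 6 + j)%nat -> M' (base + a)%nat = w a) /\
    (forall r, (6 <= r < base \/ base + 6 + j <= r)%nat -> M' r = w r)).
  { induction j as [|j IH]; intros Hj.
    - exists M. rewrite Nat.add_0_r. repeat split; auto.
      + apply reach_refl.
      + rewrite H3. simpl. lra.
      + intros r Hr. apply Hrest. lia.
    - destruct IH as (M' & R' & V1 & V2 & V3 & Vl & Vr); [lia|].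
      eexists. split; [|split; [|split; [|split; [|split]]]].
      + replace (6 * S j)%nat with (6 * j + 6)%nat by lia.
        eapply reach_trans; [exact R'|].
        eapply reach_jump_no; [exact I1|rewrite V1, V3; apply lt_INR; lia|].
        eapply reach_add; [exact I2|].
        eapply reach_load with (k := (6 + j)%nat); [exact I3|upd_simpl; exact V3|].
        upd_simpl. rewrite (Vr (6 + j)%nat) by lia.
        eapply reach_store with (k := (base + (6 + j))%nat);
          [exact I4|upd_simpl; rewrite V1, V3, (plus_INR base); reflexivity|].
        eapply reach_add; [exact I5|].
        eapply reach_jump_yes; [exact I6|lra|]. apply reach_refl.
      + upd_simpl. exact V1.
      + upd_simpl. exact V2.
      + upd_simpl. rewrite V3, V2, <- S_INR. now rewrite <- Nat.add_succ_r.
      + intros a Ha. destruct (Nat.eq_dec a (6 + j)) as [->|Hne].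
        * now upd_simpl.
        * upd_simpl. apply Vl. lia.
      + intros r Hr. upd_simpl. apply Vr. lia. }
  destruct (Loop (base - 6)%nat) as (M' & R' & V1 & V2 & V3 & Vl & Vr); [lia|].
  eexists. split; [|split].
  - eapply reach_weaken with (T1 := (6 * (base - 6) + 3)%nat); [|lia].
    eapply reach_trans; [exact R'|].
    eapply reach_jump_yes; [exact I1|rewrite V1, V3; apply le_INR; lia|].
    replace (L + 6)%nat with (S (S (S (S (S (S L)))))) by lia.
    eapply reach_const; [exact I7|]. eapply reach_add; [exact I8|].
    replace (L + 8)%nat with (S (S (S (S (S (S (S (S L)))))))) by lia. apply reach_refl.
  - upd_simpl. rewrite V1. lra.
  (* From offset [base] on nothing was copied, but there both the old and the new cell are 0. *)
  - intros a. upd_simpl. destruct (le_lt_dec base a) as [Ha|Ha].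
    + rewrite Vr by lia. now rewrite !Hz by lia.
    + apply Vl. lia.
Qed.

(** With no free cell for a multiplier, [m] is scaled by repeated doubling; [2 ^ d * m] exceeds the
    share [d * m] of the voters, and the multiple of [n] covers the rest. *)
Definition relocate (d k : nat) : program :=
  repeat (IAdd 1 1 1) d ++ repeat (IAdd 1 1 0) k ++ save_low d k ++ copy_loop (d + k + 21).

Lemma relocate_correct d K rest n m w :
  (1 <= n)%nat -> w 0%nat = INR n -> w 1%nat = INR m ->
  (forall a, (3 + n * d + m * d + n <= a)%nat -> w a = 0) ->
  let k := (d + 12 + K)%nat in
  exists base M',
    (K < base)%nat /\
    reach (relocate d k ++ rest) 0 w
      (24 + d + k + 6 * (2 ^ d + k) * (n + m)) (length (relocate d k)) M' /\
    M' 0%nat = INR base /\ forall a, M' (base + a)%nat = w a.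
Proof.
  intros Hn H0 H1 Hz k. set (P := relocate d k ++ rest).
  assert (HP : code_at P 0 (relocate d k)) by apply (code_at_embed [] (relocate d k) rest).
  assert (Hlen : length (relocate d k) = (d + k + 21 + 8)%nat).
  { unfold relocate. rewrite !length_app, !repeat_length. simpl. lia. }
  rewrite Hlen. unfold relocate in HP.
  apply code_at_app in HP as [HP1 HP]. apply code_at_app in HP as [HP2 HP].
  apply code_at_app in HP as [HP3 HP4]. rewrite !repeat_length in *.
  change (length (save_low d k)) with 21%nat in HP4. rewrite Nat.add_0_l in *.
  assert (Hd : (d < 2 ^ d)%nat) by (apply Nat.pow_gt_lin_r; lia).
  (* As [n] is at least 1, the constant 12 in [k] pays for the header, the scoring table, the
     subtracted 2 and some slack; [K] reserves registers. *)
  set (base := (2 ^ d * m + k * n - 2)%nat).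
  assert (Hbase : (base + 2 = 2 ^ d * m + k * n)%nat) by (unfold base; nia).
  assert (Hlb : (3 + n * d + m * d + n + K + 5 <= base)%nat) by (unfold k in *; nia).
  destruct (reach_repeat_double P d 0 w HP1) as (M1 & R1 & V1 & A1).
  destruct (reach_repeat_add P k d M1 HP2) as (M2 & R2 & V2 & A2).
  assert (HbR : INR base + 2 = 2 ^ d * INR m + INR k * INR n).
  { apply (f_equal INR) in Hbase. rewrite !plus_INR, !mult_INR, pow_INR in Hbase.
    simpl (INR 2) in Hbase. replace (1 + 1) with 2 in Hbase by lra. exact Hbase. }
  destruct (save_low_correct P (d + k) d k n m base w M2 HP3)
    as (M3 & R3 & W1 & W2 & W3 & Wl & Wr); auto.
  { lia. }
  { rewrite V2, V1, A1, H0, H1 by lia. lra. }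
  { intros r Hr. now rewrite A2, A1. }
  destruct (copy_loop_correct P (d + k + 21) base w M3) as (M4 & R4 & Z0 & Zl); auto.
  { lia. }
  { intros a Ha. apply Hz. lia. }
  exists base, M4. split; [lia|]. split; [|split; assumption].
  eapply reach_weaken.
  - eapply reach_trans; [exact R1|]. eapply reach_trans; [exact R2|].
    eapply reach_trans; [exact R3|exact R4].
  - nia.
Qed.

(** The program relocates the input, evaluates [F] without loop indices from register 1 on, and
    moves the result to cell 0. *)
Lemma machine_of_computable {X} (inp : X -> nat -> R) (n m : X -> nat) (d : nat) F :
  (forall x, (1 <= n x)%nat /\ inp x 0%nat = INR (n x) /\ inp x 1%nat = INR (m x) /\
     forall a, (3 + n x * d + m x * d + n x <= a)%nat -> inp x a = 0) ->
  computable inp (fun x => n x + m x)%nat F ->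
  exists (P : program) (C e : nat), forall x, exists t s,
    steps P (mkState 0 (inp x)) t s /\ halted P s /\
    (t <= C * (n x + m x + 1) ^ e)%nat /\ mem s 0%nat = F x [].
Proof.
  intros Hinp (h & gen & T & HT & H).
  (* The evaluation uses registers 1 to [1 + h], all of which must lie below [base]. *)
  set (K := S h). set (k := (d + 12 + K)%nat).
  set (pre := relocate d k).
  set (c := gen [] 1%nat (length pre)).
  set (post := [IConst 0 0; IAdd 0 0 1; IHalt]).
  destruct (poly_bounded_add (fun N => 24 + d + k + 6 * (2 ^ d + k) * N)%nat
              (fun N => T N + 2)%nat) as (C & e & HCe).
  { apply poly_bounded_add; [apply poly_bounded_const|].
    apply poly_bounded_mul; [apply poly_bounded_const|apply poly_bounded_id]. }
  { apply poly_bounded_add; [exact HT|apply poly_bounded_const]. }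
  exists (pre ++ c ++ post), C, e. intros x.
  destruct (Hinp x) as (Hn & H0 & H1 & Hz).
  destruct (relocate_correct d K (c ++ post) (n x) (m x) (inp x) Hn H0 H1 Hz)
    as (base & M1 & HK & R1 & V1 & A1).
  fold k pre in R1. set (P := pre ++ c ++ post) in *.
  destruct (H P [] 1%nat (length pre) x [] M1 base) as (M2 & R2 & V2 & A2).
  { apply code_at_embed. }
  { unfold K in HK. lia. }
  { repeat split; auto. }
  fold c in R2. cbv beta in R2.
  assert (HP : code_at P (length pre + length c) post).
  { pose proof (code_at_embed (pre ++ c) post []) as E.
    rewrite app_nil_r, <- app_assoc, length_app in E. exact E. }
  unfold post in HP. next HP I1. next HP I2. next HP I3.
  assert (R3 : reach P (length pre) M1 (T (n x + m x)%nat + 2)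
    (S (S (length pre + length c))) (upd (upd M2 0 0) 0 (0 + M2 1%nat))).
  { eapply reach_trans; [exact R2|].
    eapply reach_const; [exact I1|]. eapply reach_add; [exact I2|]. upd_simpl.
    apply reach_refl. }
  destruct (reach_trans _ _ _ _ _ _ _ _ _ R1 R3) as (t & Ht & Hs).
  exists t, (mkState (S (S (length pre + length c))) (upd (upd M2 0 0) 0 (0 + M2 1%nat))).
  split; [exact Hs|]. split; [exact I3|]. split.
  - etransitivity; [exact Ht|]. apply HCe.
  - simpl mem. rewrite upd_same, V2. lra.
Qed.

(** * Derived closure properties: booleans, conditionals, distances, bounded quantifiers *)

Section DerivedComputability.
Context {X : Type} (inp : X -> nat -> R) (size : X -> nat).
Notation computable := (computable inp size).
Notation computableb := (computableb inp size).
Notation computablen := (computablen inp size).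

Lemma computablen_const c : computablen (fun _ _ => c).
Proof.
  apply computable_ext with (fun _ _ => IZR (Z.of_nat c)).
  - intros. symmetry. apply INR_IZR_INZ.
  - apply computable_const.
Qed.

Lemma computablen_add a b : computablen a -> computablen b ->
  computablen (fun x g => a x g + b x g)%nat.
Proof.
  intros Ha Hb. eapply computable_ext; [|exact (computable_add _ _ _ _ Ha Hb)].
  intros. symmetry. apply plus_INR.
Qed.

Lemma computablen_mul a b : computablen a -> computablen b ->
  computablen (fun x g => a x g * b x g)%nat.
Proof.
  intros Ha Hb. eapply computable_ext; [|exact (computable_mul _ _ _ _ Ha Hb)].
  intros. symmetry. apply mult_INR.
Qed.

Lemma computablen_S a : computablen a -> computablen (fun x g => S (a x g)).
Proof.
  intros Ha. apply (computablen_add (fun _ _ => 1%nat)); [apply computablen_const|exact Ha].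
Qed.

Lemma computablen_b2n b : computableb b ->
  computablen (fun x g => if b x g then 1%nat else 0%nat).
Proof. intros Hb. exact Hb. Qed.

Lemma computableb_negb b : computableb b -> computableb (fun x g => negb (b x g)).
Proof.
  intros Hb. eapply computable_ext;
    [|exact (computable_sub _ _ _ _ (computable_const _ _ 1) Hb)].
  intros. simpl. destruct (b x gamma); simpl; lra.
Qed.

Lemma computableb_andb b c : computableb b -> computableb c ->
  computableb (fun x g => b x g && c x g).
Proof.
  intros Hb Hc. eapply computable_ext; [|exact (computable_mul _ _ _ _ Hb Hc)].
  intros. simpl. destruct (b x gamma), (c x gamma); simpl; lra.
Qed.

Lemma computableb_orb b c : computableb b -> computableb c ->
  computableb (fun x g => b x g || c x g).
Proof.
  intros Hb Hc. eapply computable_ext;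
    [|exact (computableb_negb _ (computableb_andb _ _ (computableb_negb _ Hb)
        (computableb_negb _ Hc)))].
  intros. simpl. now destruct (b x gamma), (c x gamma).
Qed.

Lemma computableb_ltb F G : computable F -> computable G ->
  computableb (fun x g => Rltb (F x g) (G x g)).
Proof.
  intros HF HG. eapply computable_ext;
    [|exact (computableb_negb _ (computableb_leb _ _ _ _ HG HF))].
  intros. simpl. unfold Rltb, Rleb.
  destruct (Rlt_dec (F x gamma) (G x gamma)), (Rle_dec (G x gamma) (F x gamma));
    simpl; try lra; reflexivity.
Qed.

Lemma computableb_eqb a b : computablen a -> computablen b ->
  computableb (fun x g => Nat.eqb (a x g) (b x g)).
Proof.
  intros Ha Hb. eapply computable_ext;
    [|exact (computableb_andb _ _ (computableb_leb _ _ _ _ Ha Hb)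
        (computableb_leb _ _ _ _ Hb Ha))].
  intros. simpl. unfold Rleb. f_equal.
  destruct (Nat.eqb_spec (a x gamma) (b x gamma)) as [->|Hne].
  - destruct (Rle_dec (INR (b x gamma)) (INR (b x gamma))); [reflexivity|lra].
  - destruct (Rle_dec (INR (a x gamma)) (INR (b x gamma))) as [H1|],
      (Rle_dec (INR (b x gamma)) (INR (a x gamma))) as [H2|]; try reflexivity.
    apply INR_le in H1, H2. lia.
Qed.

(** The conditional is [b * F + (1 - b) * G]. Evaluating both branches is safe, since every
    operation is total: division by zero yields 0. *)
Lemma computable_if b F G : computableb b -> computable F -> computable G ->
  computable (fun x g => if b x g then F x g else G x g).
Proof.
  intros Hb HF HG. eapply computable_ext;
    [|exact (computable_add _ _ _ _ (computable_mul _ _ _ _ Hb HF)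
        (computable_mul _ _ _ _ (computableb_negb _ Hb) HG))].
  intros. simpl. destruct (b x gamma); simpl; lra.
Qed.

Lemma computablen_if b u v : computableb b -> computablen u -> computablen v ->
  computablen (fun x g => if b x g then u x g else v x g).
Proof.
  intros Hb Hu Hv. eapply computable_ext; [|exact (computable_if _ _ _ Hb Hu Hv)].
  intros. simpl. now destruct (b x gamma).
Qed.

Lemma computable_max F G : computable F -> computable G ->
  computable (fun x g => Rmax (F x g) (G x g)).
Proof.
  intros HF HG. eapply computable_ext;
    [|exact (computable_if _ _ _ (computableb_leb _ _ _ _ HF HG) HG HF)].
  intros. simpl. unfold Rleb, Rmax. now destruct (Rle_dec (F x gamma) (G x gamma)).
Qed.

Lemma computable_abs F : computable F -> computable (fun x g => Rabs (F x g)).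
Proof.
  intros HF. eapply computable_ext;
    [|exact (computable_max _ _ HF (computable_sub _ _ _ _ (computable_const _ _ 0) HF))].
  intros. simpl. unfold Rabs, Rmax.
  destruct (Rcase_abs (F x gamma)), (Rle_dec (F x gamma) (0 - F x gamma)); lra.
Qed.

Lemma computable_half F : computable F -> computable (fun x g => F x g / 2).
Proof.
  intros HF. eapply computable_ext;
    [|exact (computable_rdiv0 _ _ _ _ HF (computable_const _ _ 2))].
  intros. simpl. unfold rdiv0. destruct (Req_EM_T 2 0); lra.
Qed.

(** The maximum over coordinates is unrolled into the code rather than looped, as [d] does not vary
    with the input. *)
Lemma computable_linf d (u v : X -> list nat -> point) :
  (forall k, (k < d)%nat -> computable (fun x g => u x g k)) ->
  (forall k, (k < d)%nat -> computable (fun x g => v x g k)) ->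
  computable (fun x g => linf d (u x g) (v x g)).
Proof.
  intros Hu Hv. unfold linf.
  assert (H : forall l, (forall k, In k l -> (k < d)%nat) ->
    computable (fun x g => fold_right Rmax 0 (map (fun k => Rabs (u x g k - v x g k)) l))).
  { induction l as [|k l IH]; intros Hl; simpl; [apply computable_const|].
    apply computable_max.
    - apply computable_abs, computable_sub; [apply Hu|apply Hv]; apply Hl; now left.
    - apply IH. intros k' Hk'. apply Hl. now right. }
  apply H. intros k Hk. apply in_seq in Hk. lia.
Qed.

Section BoundedRange.
Context (b : X -> nat) (B : nat -> nat) (HB : poly_bounded B)
  (HbB : forall x, (b x <= B (size x))%nat) (Hb : computablen (fun x _ => b x)).

(** A count is a sum of indicators; the bounded quantifiers below test whether a count is zero. *)
Lemma computablen_count o (c : X -> list nat -> nat -> bool) :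
  computableb (fun x g => c x (tl g) (o + hd 0 g)%nat) ->
  computablen (fun x g => length (filter (c x g) (seq o (b x)))).
Proof.
  intros Hc. eapply computable_ext;
    [|exact (computable_sum _ _ (fun x g k => INR (Nat.b2n (c x g (o + k)%nat))) b B
        HB HbB Hb Hc)].
  intros x g. simpl. generalize (b x) as k. induction k as [|k IH]; [reflexivity|].
  rewrite sumR_seq_S, IH, seq_S, filter_app, length_app, plus_INR. f_equal.
  simpl. now destruct (c x g (o + k)%nat).
Qed.

Lemma computableb_existsb o (c : X -> list nat -> nat -> bool) :
  computableb (fun x g => c x (tl g) (o + hd 0 g)%nat) ->
  computableb (fun x g => existsb (c x g) (seq o (b x))).
Proof.
  intros Hc. eapply computable_ext;
    [|exact (computableb_negb _ (computableb_eqb _ _ (computablen_count o c Hc)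
        (computablen_const 0)))].
  intros x g. simpl. f_equal. f_equal.
  induction (seq o (b x)) as [|k l IH]; [reflexivity|].
  simpl. destruct (c x g k); [reflexivity|exact IH].
Qed.

Lemma computableb_forallb o (c : X -> list nat -> nat -> bool) :
  computableb (fun x g => c x (tl g) (o + hd 0 g)%nat) ->
  computableb (fun x g => forallb (c x g) (seq o (b x))).
Proof.
  intros Hc. eapply computable_ext;
    [|exact (computableb_negb _ (computableb_existsb o (fun x g k => negb (c x g k))
        (computableb_negb _ Hc)))].
  intros x g. simpl. f_equal. f_equal.
  induction (seq o (b x)) as [|k l IH]; [reflexivity|].
  simpl. rewrite negb_orb, negb_involutive, IH. reflexivity.
Qed.

End BoundedRange.
End DerivedComputability.

(** * Which data ranks and scores depend on *)

Lemma Rleb_true a b : Rleb a b = true <-> a <= b.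
Proof. unfold Rleb. destruct (Rle_dec a b); split; intros; easy. Qed.

Lemma Rltb_negb_Rleb a b : Rltb a b = negb (Rleb b a).
Proof. unfold Rltb, Rleb. destruct (Rlt_dec a b), (Rle_dec b a); reflexivity || lra. Qed.

Lemma Rleb_congr a b a' b' : (a <= b <-> a' <= b') -> Rleb a b = Rleb a' b'.
Proof. intros H. apply eq_true_iff_eq. now rewrite !Rleb_true. Qed.

Lemma linf_le d u v r :
  linf d u v <= r <-> 0 <= r /\ forall k, (k < d)%nat -> Rabs (u k - v k) <= r.
Proof.
  unfold linf.
  assert (H : forall l, fold_right Rmax 0 (map (fun k => Rabs (u k - v k)) l) <= r <->
    0 <= r /\ forall k, In k l -> Rabs (u k - v k) <= r).
  { induction l as [|k l IH]; simpl; [tauto|].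
    split.
    - intros H. assert (H1 := Rle_trans _ _ _ (Rmax_l _ _) H).
      assert (H2 := Rle_trans _ _ _ (Rmax_r _ _) H). apply IH in H2 as [H2 H3].
      split; [exact H2|]. intros k' [<-|Hk']; auto.
    - intros [H1 H2]. apply Rmax_lub; [apply H2; now left|].
      apply IH. split; auto. }
  rewrite H. split; intros [H1 H2]; split; auto; intros k Hk; apply H2.
  - apply in_seq. lia.
  - apply in_seq in Hk. lia.
Qed.

Lemma linf_ext d u v u' v' :
  (forall k, (k < d)%nat -> u k = u' k) -> (forall k, (k < d)%nat -> v k = v' k) ->
  linf d u v = linf d u' v'.
Proof.
  intros Hu Hv. unfold linf. f_equal. apply map_ext_in. intros k Hk.
  apply in_seq in Hk. rewrite Hu, Hv by lia. reflexivity.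
Qed.

(** A rival is strictly nearer than the target exactly when the target is outside the closed cube
    through that rival, so cube memberships also settle the target's own rank. *)
Lemma rank_congr d n cand cand' p p' v v' j :
  (forall j', (1 <= j' < n)%nat -> linf d v (cand j') = linf d v' (cand' j')) ->
  (forall j', (1 <= j' < n)%nat ->
     (linf d v p <= linf d v (cand j') <-> linf d v' p' <= linf d v' (cand' j'))) ->
  (j < n)%nat -> rank d n cand p v j = rank d n cand' p' v' j.
Proof.
  intros Hc Hp Hj. unfold rank. destruct (Nat.eqb_spec j 0) as [->|Hj0].
  - do 2 f_equal. apply filter_ext_in. intros j' Hj'. apply in_seq in Hj'.
    rewrite !Rltb_negb_Rleb. f_equal. apply Rleb_congr, Hp. lia.
  - f_equal. f_equal.
    + f_equal. apply filter_ext_in. intros j' Hj'. apply in_seq in Hj'.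
      now rewrite !Hc by lia.
    + now rewrite (Rleb_congr _ _ _ _ (Hp j ltac:(lia))).
Qed.

Lemma rank_bounds d n cand p v j : (j < n)%nat -> (1 <= rank d n cand p v j <= n)%nat.
Proof.
  intros Hj. unfold rank. destruct (Nat.eqb_spec j 0) as [->|Hj0].
  - split; [lia|]. pose proof (filter_length_le
      (fun j' => Rltb (linf d v (cand j')) (linf d v p)) (seq 1 (n - 1))) as H.
    rewrite length_seq in H. lia.
  - split; [lia|]. set (g := fun j' => _ && _).
    (* The filter rejects [j] itself, which leaves room for the extra 1 contributed by the
       target. *)
    assert (H : (length (filter g (seq 1 (n - 1))) < length (seq 1 (n - 1)))%nat).
    { apply Nat.le_neq. split; [apply filter_length_le|].
      intros E. apply filter_length_forallb in E. rewrite forallb_forall in E.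
      specialize (E j). unfold g in E. rewrite Nat.eqb_refl in E.
      assert (false = true) by (apply E, in_seq; lia). discriminate. }
    rewrite length_seq in H. destruct (Rleb _ _); lia.
Qed.

Lemma score_congr d n m cand cand' voter voter' f f' p p' j :
  (forall i j', (i < m)%nat -> (1 <= j' < n)%nat ->
     linf d (voter i) (cand j') = linf d (voter' i) (cand' j')) ->
  (forall i j', (i < m)%nat -> (1 <= j' < n)%nat ->
     (linf d (voter i) p <= linf d (voter i) (cand j') <->
      linf d (voter' i) p' <= linf d (voter' i) (cand' j'))) ->
  (forall t, (1 <= t <= n)%nat -> f t = f' t) ->
  (j < n)%nat ->
  score d n m cand voter f p j = score d n m cand' voter' f' p' j.
Proof.
  intros Hc Hp Hf Hj. unfold score. f_equal. apply map_ext_in. intros i Hi.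
  apply in_seq in Hi.
  rewrite (rank_congr d n cand cand' p p' (voter i) (voter' i) j); auto.
  - apply Hf, rank_bounds, Hj.
  - intros. apply Hc; lia.
  - intros. apply Hp; lia.
Qed.

(** Used to pass between an instance and its copy read back from memory, which agree only on
    meaningful indices. *)
Lemma controllable_congr d n m cand cand' voter voter' f f' eps :
  (1 <= n)%nat ->
  (forall j k, (j < n)%nat -> (k < d)%nat -> cand j k = cand' j k) ->
  (forall i k, (i < m)%nat -> (k < d)%nat -> voter i k = voter' i k) ->
  (forall t, (1 <= t <= n)%nat -> f t = f' t) ->
  controllable d n m cand voter f eps -> controllable d n m cand' voter' f' eps.
Proof.
  intros Hn Hc Hv Hf (p & Hbox & Hwin). exists p. split.
  - intros k Hk. rewrite <- Hc by lia. now apply Hbox.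
  - intros j Hj.
    assert (E : forall j, (j < n)%nat ->
      score d n m cand' voter' f' p j = score d n m cand voter f p j).
    { intros j0 Hj0. symmetry.
      assert (E1 : forall i j', (i < m)%nat -> (1 <= j' < n)%nat ->
        linf d (voter i) (cand j') = linf d (voter' i) (cand' j')).
      { intros i j' Hi Hj'. apply linf_ext; intros; [apply Hv|apply Hc]; lia. }
      apply score_congr; auto.
      intros i j' Hi Hj'. rewrite (E1 i j' Hi Hj').
      rewrite (linf_ext d (voter i) p (voter' i) p); [tauto| |auto].
      intros; apply Hv; lia. }
    rewrite !E by lia. now apply Hwin.
Qed.

(** * Replacing a coordinate by a midpoint of critical values *)

Definition same_side (L : list R) (x y : R) : Prop :=
  forall c, In c L -> (c <= x <-> c <= y) /\ (x <= c <-> y <= c).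


(** The value [lo] is a fallback for when no member of [L] lies below [x]. *)
Lemma greatest_below L x lo : lo <= x ->
  exists a, (a = lo \/ In a L) /\ lo <= a <= x /\ forall c, In c L -> c <= x -> c <= a.
Proof.
  revert lo. induction L as [|c L IH]; intros lo Hle.
  - exists lo. split; [now left|]. split; [lra|]. intros c [].
  - destruct (IH lo Hle) as (a & Ha & Hax & Hmax).
    destruct (Rle_dec c x) as [Hc|Hc].
    + destruct (Rle_dec c a).
      * exists a. split; [simpl; tauto|]. split; [exact Hax|].
        intros c' [<-|Hc'] Hx; auto.
      * exists c. split; [simpl; tauto|]. split; [lra|].
        intros c' [<-|Hc'] Hx; [lra|]. specialize (Hmax c' Hc' Hx). lra.
    + exists a. split; [simpl; tauto|]. split; [exact Hax|].
      intros c' [<-|Hc'] Hx; [contradiction|auto].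
Qed.

Lemma least_above L x hi : x <= hi ->
  exists b, (b = hi \/ In b L) /\ x <= b <= hi /\ forall c, In c L -> x <= c -> b <= c.
Proof.
  intros Hle. destruct (greatest_below (map Ropp L) (- x) (- hi)) as (a & Ha & Hax & Hmax).
  - lra.
  - exists (- a). split; [|split; [lra|]].
    + destruct Ha as [->|Ha]; [left; lra|right].
      apply in_map_iff in Ha as (c & <- & Hc). now rewrite Ropp_involutive.
    + intros c Hc Hx. specialize (Hmax (- c)). apply (in_map Ropp) in Hc.
      specialize (Hmax Hc). lra.
Qed.

(** Take the greatest member [a] below or at [x] and the least member [b] above or at it. If [x] is
    in [L], both equal [x]; otherwise [x] and the midpoint lie strictly between [a] and [b], with no
    member of [L] in between. *)
Lemma midpoint_same_side L x lo hi :
  In lo L -> In hi L -> lo <= x <= hi ->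
  exists a b, In a L /\ In b L /\ same_side L x ((a + b) / 2).
Proof.
  intros Hlo Hhi Hx.
  destruct (greatest_below L x lo) as (a & Ha & Hax & Hmax); [lra|].
  destruct (least_above L x hi) as (b & Hb & Hbx & Hmin); [lra|].
  assert (Ha' : In a L) by (destruct Ha as [->|]; assumption).
  assert (Hb' : In b L) by (destruct Hb as [->|]; assumption).
  exists a, b. split; [exact Ha'|]. split; [exact Hb'|].
  intros c Hc. specialize (Hmax c Hc). specialize (Hmin c Hc).
  specialize (Rle_dec c x) as [Hcx|Hcx]; specialize (Rle_dec x c) as [Hxc|Hxc];
    repeat match goal with
    | H : ?A -> _, H' : ?A |- _ => specialize (H H')
    end; split; split; lra.
Qed.

(** * The search over midpoints and its correctness *)

Section Search.
Context (d n m : nat) (cand voter : nat -> point) (f : nat -> R) (eps : R).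

Definition good (p : point) : bool :=
  forallb (fun k => Rleb (Rabs (p k - cand 0%nat k)) eps) (seq 0 d) &&
  forallb (fun j => Rleb (score d n m cand voter f p j) (score d n m cand voter f p 0))
    (seq 1 (n - 1)).

Lemma good_true p : good p = true <->
  (forall k, (k < d)%nat -> Rabs (p k - cand 0%nat k) <= eps) /\
  target_wins d n m cand voter f p.
Proof.
  unfold good, target_wins. rewrite andb_true_iff, !forallb_forall.
  split; intros [H1 H2]; split.
  - intros k Hk. apply Rleb_true, H1, in_seq. lia.
  - intros j Hj. apply Rleb_true, H2, in_seq. lia.
  - intros k Hk. apply in_seq in Hk. apply Rleb_true, H1. lia.
  - intros j Hj. apply in_seq in Hj. apply Rleb_true, H2. lia.
Qed.

(** The two box faces serve twice: they make membership in the box a matter of sides, and they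
    guarantee a critical value on each side of an admissible coordinate. *)
Definition critical (k : nat) : list R :=
  (cand 0%nat k - eps) :: (cand 0%nat k + eps) ::
  flat_map (fun i => flat_map (fun j =>
    [voter i k - linf d (voter i) (cand j); voter i k + linf d (voter i) (cand j)])
    (seq 1 (n - 1))) (seq 0 m).

Lemma critical_voter k i j : (i < m)%nat -> (1 <= j < n)%nat ->
  In (voter i k - linf d (voter i) (cand j)) (critical k) /\
  In (voter i k + linf d (voter i) (cand j)) (critical k).
Proof.
  intros Hi Hj. split; right; right; apply in_flat_map; exists i;
    (split; [apply in_seq; lia|]); apply in_flat_map; exists j;
    (split; [apply in_seq; lia|]); simpl; auto.
Qed.

(* Whether the target wins depends on [p] only through the closed cubes around
   the voters that contain it, and their faces lie on the critical hyperplanes. *)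
Lemma good_same_side p p' :
  (1 <= n)%nat ->
  (forall k, (k < d)%nat -> same_side (critical k) (p k) (p' k)) ->
  good p = true -> good p' = true.
Proof.
  intros Hn Hs. rewrite !good_true. intros [Hbox Hwin]. split.
  - intros k Hk. specialize (Hbox k Hk).
    destruct (Hs k Hk (cand 0%nat k - eps)) as [[A _] _]; [now left|].
    destruct (Hs k Hk (cand 0%nat k + eps)) as [_ [B _]]; [right; now left|].
    apply Rabs_le. unfold Rabs in Hbox. destruct (Rcase_abs _) in Hbox; lra.
  - assert (E : forall i j, (i < m)%nat -> (1 <= j < n)%nat ->
      (linf d (voter i) p <= linf d (voter i) (cand j) <->
       linf d (voter i) p' <= linf d (voter i) (cand j))).
    { intros i j Hi Hj. rewrite !linf_le. set (r := linf d (voter i) (cand j)).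
      assert (K : forall k, (k < d)%nat ->
        (Rabs (voter i k - p k) <= r <-> Rabs (voter i k - p' k) <= r)).
      { intros k Hk. destruct (critical_voter k i j Hi Hj) as [C1 C2].
        destruct (Hs k Hk _ C1) as [[A1 A2] _]. destruct (Hs k Hk _ C2) as [_ [B1 B2]].
        fold r in A1, A2, B1, B2.
        split; intros Hr; apply Rabs_le;
          unfold Rabs in Hr; destruct (Rcase_abs _) in Hr; lra. }
      split; intros [H1 H2]; split; auto; intros k Hk; apply K; auto. }
    intros j Hj.
    rewrite <- !(score_congr d n m cand cand voter voter f f p p') by (auto || lia).
    now apply Hwin.
Qed.

(** Coordinates from [q] on are already chosen in [p]; those below [q] will be overwritten, from the
    highest down. *)
Fixpoint search (q : nat) (p : point) : bool :=
  match q with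
  | 0%nat => good p
  | S q => existsb (fun a => existsb (fun b => search q (upd p q ((a + b) / 2)))
             (critical q)) (critical q)
  end.

Lemma search_sound q : forall p, search q p = true -> exists p', good p' = true.
Proof.
  induction q as [|q IH]; intros p H; [now exists p|].
  cbn [search] in H. apply existsb_exists in H as (a & _ & H).
  apply existsb_exists in H as (b & _ & H). now apply IH in H.
Qed.

(** The witness [p'] is changed along with [p]: its coordinate [q] moves to a midpoint on the same
    sides, which keeps it good and extends its agreement with [p]. *)
Lemma search_complete q : (1 <= n)%nat -> (q <= d)%nat -> forall p p',
  (forall k, (q <= k < d)%nat -> p' k = p k) -> good p' = true -> search q p = true.
Proof.
  intros Hn. induction q as [|q IH]; intros Hq p p' Heq Hgood.
  (* The two points agree only on coordinates below [d], so goodness is transported instead of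
     rewritten. *)
  - apply good_same_side with p'; [exact Hn| |exact Hgood].
    intros k Hk c _. rewrite Heq by lia. tauto.
  - cbn [search]. destruct (midpoint_same_side (critical q) (p' q) (cand 0%nat q - eps)
      (cand 0%nat q + eps)) as (a & b & Ha & Hb & Hab).
    + now left.
    + right. now left.
    + apply good_true in Hgood as [Hbox _]. specialize (Hbox q ltac:(lia)).
      unfold Rabs in Hbox. destruct (Rcase_abs _) in Hbox; lra.
    + apply existsb_exists. exists a. split; [exact Ha|].
      apply existsb_exists. exists b. split; [exact Hb|].
      apply IH with (upd p' q ((a + b) / 2)); [lia| |].
      * intros k Hk. destruct (Nat.eq_dec k q) as [->|Hne]; upd_simpl; [reflexivity|].
        apply Heq. lia.
      * apply good_same_side with p'; [exact Hn| |exact Hgood].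
        intros k Hk. destruct (Nat.eq_dec k q) as [->|Hne]; upd_simpl; [exact Hab|].
        intros c _. tauto.
Qed.

Lemma search_controllable p : (1 <= n)%nat ->
  search d p = true <-> controllable d n m cand voter f eps.
Proof.
  intros Hn. split.
  - intros H. apply search_sound in H as [p' H]. exists p'. now apply good_true.
  - intros [p' H]. apply search_complete with p'; [exact Hn|lia|intros; lia|].
    now apply good_true.
Qed.

End Search.

(** * Reading an instance from memory and computing the search *)

Record instance := {
  num_cand : nat;
  num_voter : nat;
  inst_cand : nat -> point;
  inst_voter : nat -> point;
  inst_f : nat -> R;
  inst_eps : R;
  num_cand_pos : (1 <= num_cand)%nat
}.

Section Decision.
Context (d : nat).

Definition input (x : instance) : nat -> R :=
  encode d (num_cand x) (num_voter x) (inst_cand x) (inst_voter x) (inst_f x) (inst_eps x).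

Definition input_size (x : instance) : nat := (num_cand x + num_voter x)%nat.

(* The instance as read back from memory; it agrees with the original one on the
   indices that occur in the problem, and is computable at all indices. *)
Definition cand_in (x : instance) (j : nat) : point := fun k => input x (3 + j * d + k)%nat.
Definition voter_in (x : instance) (i : nat) : point :=
  fun k => input x (3 + num_cand x * d + i * d + k)%nat.
(** Ranks start at 1 while the table starts at offset 3, hence the 2. *)
Definition f_in (x : instance) (t : nat) : R :=
  input x (2 + num_cand x * d + num_voter x * d + t)%nat.

Lemma cand_in_eq x j k : (j < num_cand x)%nat -> (k < d)%nat ->
  cand_in x j k = inst_cand x j k.
Proof.
  intros Hj Hk. unfold cand_in, input, encode.
  replace (Nat.eqb _ 0) with false by (symmetry; apply Nat.eqb_neq; lia).
  replace (Nat.eqb _ 1) with false by (symmetry; apply Nat.eqb_neq; lia).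
  replace (Nat.eqb _ 2) with false by (symmetry; apply Nat.eqb_neq; lia).
  replace (Nat.ltb _ _) with true by (symmetry; apply Nat.ltb_lt; nia).
  replace (3 + j * d + k - 3)%nat with (k + j * d)%nat by lia.
  rewrite Nat.div_add, Nat.Div0.mod_add, Nat.div_small, Nat.mod_small by lia. reflexivity.
Qed.

Lemma voter_in_eq x i k : (i < num_voter x)%nat -> (k < d)%nat ->
  voter_in x i k = inst_voter x i k.
Proof.
  intros Hi Hk. unfold voter_in, input, encode.
  replace (Nat.eqb _ 0) with false by (symmetry; apply Nat.eqb_neq; lia).
  replace (Nat.eqb _ 1) with false by (symmetry; apply Nat.eqb_neq; lia).
  replace (Nat.eqb _ 2) with false by (symmetry; apply Nat.eqb_neq; lia).
  replace (Nat.ltb _ (3 + num_cand x * d)) with false by (symmetry; apply Nat.ltb_ge; nia).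
  replace (Nat.ltb _ _) with true by (symmetry; apply Nat.ltb_lt; nia).
  replace (3 + num_cand x * d + i * d + k - 3 - num_cand x * d)%nat with (k + i * d)%nat by lia.
  rewrite Nat.div_add, Nat.Div0.mod_add, Nat.div_small, Nat.mod_small by lia. reflexivity.
Qed.

Lemma f_in_eq x t : (1 <= t <= num_cand x)%nat -> f_in x t = inst_f x t.
Proof.
  intros Ht. unfold f_in, input, encode.
  replace (Nat.eqb _ 0) with false by (symmetry; apply Nat.eqb_neq; lia).
  replace (Nat.eqb _ 1) with false by (symmetry; apply Nat.eqb_neq; lia).
  replace (Nat.eqb _ 2) with false by (symmetry; apply Nat.eqb_neq; lia).
  replace (Nat.ltb _ (3 + num_cand x * d)) with false by (symmetry; apply Nat.ltb_ge; nia).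
  replace (Nat.ltb _ (3 + num_cand x * d + num_voter x * d)) with false
    by (symmetry; apply Nat.ltb_ge; nia).
  replace (Nat.ltb _ _) with true by (symmetry; apply Nat.ltb_lt; lia).
  f_equal. lia.
Qed.

Lemma input_spec x :
  (1 <= num_cand x)%nat /\ input x 0%nat = INR (num_cand x) /\
  input x 1%nat = INR (num_voter x) /\
  forall a, (3 + num_cand x * d + num_voter x * d + num_cand x <= a)%nat -> input x a = 0.
Proof.
  split; [apply num_cand_pos|]. split; [reflexivity|]. split; [reflexivity|].
  intros a Ha. unfold input, encode.
  replace (Nat.eqb _ 0) with false by (symmetry; apply Nat.eqb_neq; lia).
  replace (Nat.eqb _ 1) with false by (symmetry; apply Nat.eqb_neq; lia).
  replace (Nat.eqb _ 2) with false by (symmetry; apply Nat.eqb_neq; lia).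
  replace (Nat.ltb _ (3 + num_cand x * d)) with false by (symmetry; apply Nat.ltb_ge; nia).
  replace (Nat.ltb _ (3 + num_cand x * d + num_voter x * d)) with false
    by (symmetry; apply Nat.ltb_ge; nia).
  replace (Nat.ltb _ _) with false by (symmetry; apply Nat.ltb_ge; lia).
  reflexivity.
Qed.

Notation computable := (computable input input_size).
Notation computableb := (computableb input input_size).
Notation computablen := (computablen input input_size).

Lemma computablen_num_cand : computablen (fun x _ => num_cand x).
Proof.
  eapply computable_ext; [|exact (computable_input input input_size _ (computablen_const _ _ 0))].
  intros. reflexivity.
Qed.

Lemma computablen_num_voter : computablen (fun x _ => num_voter x).
Proof.
  eapply computable_ext; [|exact (computable_input input input_size _ (computablen_const _ _ 1))].
  intros. reflexivity.
Qed.

Lemma computable_eps : computable (fun x _ => inst_eps x).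
Proof.
  eapply computable_ext; [|exact (computable_input input input_size _ (computablen_const _ _ 2))].
  intros. reflexivity.
Qed.

Lemma computablen_num_rivals : computablen (fun x _ => num_cand x - 1)%nat.
Proof.
  eapply computable_ext;
    [|exact (computable_sub _ _ _ _ computablen_num_cand (computable_const _ _ 1))].
  intros x g. simpl. rewrite minus_INR by apply num_cand_pos. simpl. lra.
Qed.

Lemma num_rivals_le x : (num_cand x - 1 <= input_size x)%nat.
Proof. unfold input_size. lia. Qed.

Lemma num_voter_le x : (num_voter x <= input_size x)%nat.
Proof. unfold input_size. lia. Qed.

Lemma computable_cand_in a k : computablen a ->
  computable (fun x g => cand_in x (a x g) k).
Proof.
  intros Ha. apply computable_input.
  repeat first [apply computablen_add | apply computablen_mul | apply computablen_const
               | exact Ha].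
Qed.

Lemma computable_voter_in a k : computablen a ->
  computable (fun x g => voter_in x (a x g) k).
Proof.
  intros Ha. apply computable_input.
  repeat first [exact computablen_num_cand | exact Ha
               | apply computablen_const | apply computablen_add | apply computablen_mul].
Qed.

Lemma computable_f_in a : computablen a -> computable (fun x g => f_in x (a x g)).
Proof.
  intros Ha. unfold f_in. apply computable_input.
  repeat first [exact computablen_num_cand | exact computablen_num_voter | exact Ha
               | apply computablen_const | apply computablen_add | apply computablen_mul].
Qed.

Lemma computable_dist a b : computablen a -> computablen b ->
  computable (fun x g => linf d (voter_in x (a x g)) (cand_in x (b x g))).
Proof.
  intros Ha Hb. apply computable_linf; intros k _.
  - now apply computable_voter_in.
  - now apply computable_cand_in.
Qed.

(** A point is [d] separate expressions, one per coordinate, evaluated afresh at each use. *)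
Definition computablep (p : instance -> list nat -> point) : Prop :=
  forall k, (k < d)%nat -> computable (fun x g => p x g k).

Lemma computable_dist_point a p : computablen a -> computablep p ->
  computable (fun x g => linf d (voter_in x (a x g)) (p x g)).
Proof.
  intros Ha Hp. apply computable_linf; [|exact Hp]. intros k _.
  now apply computable_voter_in.
Qed.

Lemma computablen_tl a : computablen a -> computablen (fun x g => a x (tl g)).
Proof. apply (computable_tl input input_size (fun x g => INR (a x g))). Qed.

Lemma computablep_tl p : computablep p -> computablep (fun x g => p x (tl g)).
Proof. intros Hp k Hk. apply (computable_tl input input_size (fun x g => p x g k)), Hp, Hk. Qed.

Lemma computablen_hd_offset o : computablen (fun _ g => o + hd 0 g)%nat.
Proof. apply computablen_add; [apply computablen_const|apply computable_hd]. Qed.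

Lemma computablen_rank a j p : computablen a -> computablen j -> computablep p ->
  computablen (fun x g => rank d (num_cand x) (cand_in x) (p x g) (voter_in x (a x g)) (j x g)).
Proof.
  intros Ha Hj Hp. unfold rank. apply computablen_if.
  - apply computableb_eqb; [exact Hj|apply computablen_const].
  - apply computablen_S.
    apply (computablen_count input input_size _ (fun N => N) poly_bounded_id num_rivals_le
      computablen_num_rivals 1 (fun x g j' => Rltb (linf d (voter_in x (a x g)) (cand_in x j'))
        (linf d (voter_in x (a x g)) (p x g)))).
    apply computableb_ltb.
    + apply computable_dist; [now apply computablen_tl|apply computablen_hd_offset].
    + apply computable_dist_point; [now apply computablen_tl|now apply computablep_tl].
  - apply computablen_S, computablen_add.
    + apply (computablen_count input input_size _ (fun N => N) poly_bounded_id num_rivals_le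
        computablen_num_rivals 1 (fun x g j' => negb (j' =? j x g)%nat &&
          Rltb (linf d (voter_in x (a x g)) (cand_in x j'))
            (linf d (voter_in x (a x g)) (cand_in x (j x g))))).
      apply computableb_andb.
      * apply computableb_negb, computableb_eqb;
          [apply computablen_hd_offset|now apply computablen_tl].
      * apply computableb_ltb; apply computable_dist;
          (now apply computablen_tl) || apply computablen_hd_offset.
    + apply computablen_b2n, computableb_leb.
      * now apply computable_dist_point.
      * now apply computable_dist.
Qed.

Lemma computable_score j p : computablen j -> computablep p ->
  computable (fun x g => score d (num_cand x) (num_voter x) (cand_in x) (voter_in x)
    (f_in x) (p x g) (j x g)).
Proof.
  intros Hj Hp. unfold score.
  apply (computable_sum input input_size (fun x g i =>
    f_in x (rank d (num_cand x) (cand_in x) (p x g) (voter_in x i) (j x g))) _ (fun N => N)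
    poly_bounded_id num_voter_le computablen_num_voter).
  apply computable_f_in, computablen_rank;
    [apply computable_hd|now apply computablen_tl|now apply computablep_tl].
Qed.

Lemma computableb_forallb_list (l : list nat) (c : instance -> list nat -> nat -> bool) :
  (forall k, In k l -> computableb (fun x g => c x g k)) ->
  computableb (fun x g => forallb (c x g) l).
Proof.
  induction l as [|k l IH]; intros Hc.
  - exact (computablen_const _ _ 1).
  - apply (computableb_andb input input_size (fun x g => c x g k)).
    + apply Hc. now left.
    + apply IH. intros k' Hk'. apply Hc. now right.
Qed.

Lemma computableb_good p : computablep p ->
  computableb (fun x g => good d (num_cand x) (num_voter x) (cand_in x) (voter_in x)
    (f_in x) (inst_eps x) (p x g)).
Proof.
  intros Hp. unfold good. apply computableb_andb.
  - apply (computableb_forallb_list (seq 0 d)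
      (fun x g k => Rleb (Rabs (p x g k - cand_in x 0 k)) (inst_eps x))).
    intros k Hk. apply in_seq in Hk. apply computableb_leb; [|apply computable_eps].
    apply computable_abs, computable_sub; [apply Hp; lia|].
    apply (computable_cand_in (fun _ _ => 0%nat)), computablen_const.
  - apply (computableb_forallb input input_size _ (fun N => N) poly_bounded_id num_rivals_le
      computablen_num_rivals 1 (fun x g j =>
        Rleb (score d (num_cand x) (num_voter x) (cand_in x) (voter_in x) (f_in x) (p x g) j)
          (score d (num_cand x) (num_voter x) (cand_in x) (voter_in x) (f_in x) (p x g) 0))).
    apply computableb_leb.
    + apply computable_score; [apply computablen_hd_offset|now apply computablep_tl].
    + apply (computable_score (fun _ _ => 0%nat));
        [apply computablen_const|now apply computablep_tl].
Qed.

Lemma existsb_ext {A} (c c' : A -> bool) l :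
  (forall a, c a = c' a) -> existsb c l = existsb c' l.
Proof. intros H. induction l as [|a l IH]; simpl; [reflexivity|]. now rewrite H, IH. Qed.

Lemma existsb_flat_map {A B} (c : B -> bool) (g : A -> list B) l :
  existsb c (flat_map g l) = existsb (fun a => existsb c (g a)) l.
Proof. induction l as [|a l IH]; simpl; [reflexivity|]. now rewrite existsb_app, IH. Qed.

Definition critical_in (x : instance) : nat -> list R :=
  critical d (num_cand x) (num_voter x) (cand_in x) (voter_in x) (inst_eps x).

(** The bound variable is real, so the body must be computable for every expression put in its
    place. That expression may live under [k] further loops, whose indices [skipn k] hides from the
    body: none for a box face, two (voter and rival) for a cube face. *)
Lemma computableb_existsb_critical q (c : instance -> list nat -> R -> bool) :
  (forall k F, computable F -> computableb (fun x g => c x (skipn k g) (F x g))) ->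
  computableb (fun x g => existsb (c x g) (critical_in x q)).
Proof.
  intros Hc.
  assert (H0 : computable (fun x _ => cand_in x 0 q)).
  { apply (computable_cand_in (fun _ _ => 0%nat)), computablen_const. }
  unfold critical_in, critical. cbn [existsb].
  apply computableb_orb; [|apply computableb_orb].
  - apply (Hc 0%nat (fun x _ => cand_in x 0 q - inst_eps x)).
    apply computable_sub; [exact H0|apply computable_eps].
  - apply (Hc 0%nat (fun x _ => cand_in x 0 q + inst_eps x)).
    apply computable_add; [exact H0|apply computable_eps].
  - eapply computable_ext with (F := fun x g => INR (Nat.b2n
      (existsb (fun i => existsb (fun j =>
         c x g (voter_in x i q - linf d (voter_in x i) (cand_in x j)) ||
         c x g (voter_in x i q + linf d (voter_in x i) (cand_in x j)))
         (seq 1 (num_cand x - 1))) (seq 0 (num_voter x))))).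
    { intros x g. do 2 f_equal. rewrite existsb_flat_map.
      apply existsb_ext. intros i. rewrite existsb_flat_map.
      apply existsb_ext. intros j. simpl. now rewrite orb_false_r. }
    apply (computableb_existsb input input_size _ (fun N => N) poly_bounded_id num_voter_le
      computablen_num_voter 0 (fun x g i => existsb (fun j =>
         c x g (voter_in x i q - linf d (voter_in x i) (cand_in x j)) ||
         c x g (voter_in x i q + linf d (voter_in x i) (cand_in x j)))
         (seq 1 (num_cand x - 1)))).
    apply (computableb_existsb input input_size _ (fun N => N) poly_bounded_id num_rivals_le
      computablen_num_rivals 1 (fun x g j =>
         c x (tl g) (voter_in x (0 + hd 0%nat g) q -
           linf d (voter_in x (0 + hd 0%nat g)) (cand_in x j)) ||
         c x (tl g) (voter_in x (0 + hd 0%nat g) q +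
           linf d (voter_in x (0 + hd 0%nat g)) (cand_in x j)))).
    assert (Hv : computablen (fun _ g => 0 + hd 0 (tl g))%nat).
    { apply (computablen_tl (fun _ g => 0 + hd 0 g)%nat), computablen_hd_offset. }
    assert (Hj := computablen_hd_offset 1).
    assert (Hsk : forall g : list nat, tl (tl g) = skipn 2 g) by (now intros [|? [|? ?]]).
    apply computableb_orb.
    + eapply computable_ext; [|apply (Hc 2%nat); apply computable_sub;
        [exact (computable_voter_in _ q Hv)|exact (computable_dist _ _ Hv Hj)]].
      intros x g. simpl. now rewrite Hsk.
    + eapply computable_ext; [|apply (Hc 2%nat); apply computable_add;
        [exact (computable_voter_in _ q Hv)|exact (computable_dist _ _ Hv Hj)]].
      intros x g. simpl. now rewrite Hsk.
Qed.

Definition search_in (x : instance) : nat -> point -> bool :=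
  search d (num_cand x) (num_voter x) (cand_in x) (voter_in x) (f_in x) (inst_eps x).

(** Induction on [q] unfolds the recursion into nested loops. The partially chosen point is passed
    down as a family of expressions, so it only has to be computable on the coordinates already
    chosen. *)
Lemma computableb_search q : forall p,
  (forall k, (q <= k < d)%nat -> computable (fun x g => p x g k)) ->
  computableb (fun x g => search_in x q (p x g)).
Proof.
  unfold search_in. induction q as [|q IH]; intros p Hp; cbn [search].
  - apply computableb_good. intros k Hk. apply Hp. lia.
  - apply (computableb_existsb_critical q (fun x g a => existsb (fun b =>
      search_in x q (upd (p x g) q ((a + b) / 2))) (critical_in x q))).
    intros k1 F HF.
    apply (computableb_existsb_critical q (fun x g b =>
      search_in x q (upd (p x (skipn k1 g)) q ((F x g + b) / 2)))).
    intros k2 G HG.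
    (* The first midpoint end lives under [k1] indices and the second under [k2] more, so earlier
       expressions skip the indices added after them. *)
    apply (IH (fun x g => upd (p x (skipn k1 (skipn k2 g))) q
      ((F x (skipn k2 g) + G x g) / 2))).
    intros k Hk. unfold upd. destruct (Nat.eqb_spec k q) as [->|Hne].
    + apply computable_half, computable_add; [|exact HG].
      now apply computable_skipn.
    + apply (computable_skipn input input_size k2 (fun x g => p x (skipn k1 g) k)).
      apply (computable_skipn input input_size k1 (fun x g => p x g k)).
      apply Hp. lia.
Qed.

Lemma search_in_controllable x :
  search_in x d (fun _ => 0) = true <->
  controllable d (num_cand x) (num_voter x) (inst_cand x) (inst_voter x) (inst_f x)
    (inst_eps x).
Proof.
  unfold search_in. rewrite search_controllable by apply num_cand_pos.
  split; apply controllable_congr; try apply num_cand_pos; intros;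
    first [now apply cand_in_eq | symmetry; now apply cand_in_eq
          | now apply voter_in_eq | symmetry; now apply voter_in_eq
          | now apply f_in_eq | symmetry; now apply f_in_eq].
Qed.

End Decision.

(* For every fixed dimension d there is a real-RAM program deciding
   constructive RVPM under l_infinity for arbitrary scoring rules, running
   in time polynomial in n + m. Output: M[0] = 1 (yes) or 0 (no). *)
Theorem theorem7 :
  forall d : nat,
  exists (P : program) (C e : nat),
  forall (n m : nat) (cand voter : nat -> point) (f : nat -> R) (eps : R),
    valid_instance d n m cand voter f eps ->
    exists (t : nat) (s : state),
      steps P (init_state d n m cand voter f eps) t s /\
      halted P s /\
      (t <= C * (n + m + 1) ^ e)%nat /\
      (controllable d n m cand voter f eps -> mem s 0 = 1) /\
      (~ controllable d n m cand voter f eps -> mem s 0 = 0).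
Proof.
  intros d.
  destruct (machine_of_computable (input d) num_cand num_voter d
    (fun x g => INR (Nat.b2n (search_in d x d (fun _ => 0)))) (input_spec d))
    as (P & C & e & H).
  (* At depth [d] no coordinate has been chosen, so the condition on the starting point is
     vacuous. *)
  { apply (computableb_search d d (fun _ _ _ => 0)). intros k Hk. lia. }
  exists P, C, e. intros n m cand voter f eps [Hn _].
  set (x := Build_instance n m cand voter f eps Hn).
  destruct (H x) as (t & s & Hs & Hh & Ht & Hres).
  exists t, s. split; [exact Hs|]. split; [exact Hh|]. split; [exact Ht|].
  rewrite Hres. pose proof (search_in_controllable d x) as Hx.
  change (controllable d n m cand voter f eps) with
    (controllable d (num_cand x) (num_voter x) (inst_cand x) (inst_voter x) (inst_f x)
      (inst_eps x)).
  destruct (search_in d x d (fun _ => 0)); simpl; split; intros Hc; try reflexivity.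
  - exfalso. now apply Hc, Hx.
  - apply Hx in Hc. discriminate.
Qed.
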